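(* Let $X$ be a reflexive Banach space and $T>0$. Let $\psi:X\to[0,+\infty)$ be convex, lower semicontinuous and positively homogeneous of degree $1$, with associated polar set $K^*\subset X^*$, and let $\alpha=\partial\psi$. Let $(u,\xi)\in BV([0,T];X)\times L^1(0,T;X^* )$ satisfy the energy inequality $$\mathcal E_t(u(t))+\int_0^tf_\alpha(\dot u_{\mathrm{ac}}(s),-\xi(s))\,ds+\int_0^tf_\alpha^\infty(\dot u_{\mathrm{sin}}(s),0)\,d\|(du)_{\mathrm{sin}}\|(s)\le\mathcal E_0(u(0))+\int_0^t\partial_t\mathcal E_s(u(s))\,ds$$ for all $t\in[0,T]$. Then $(u,\xi)$ satisfies $$-\xi(t)\in K^*\quad\text{for a.a. }t\in(0,T),$$ $$\mathcal E_t(u(t))+\mathrm{Var}_\psi(u;[0,t])\le\mathcal E_0(u(0))+\int_0^t\partial_t\mathcal E_s(u(s))\,ds\quad\text{for all }t\in[0,T].$$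
   Context: $\langle\cdot,\cdot\rangle$ is the duality pairing between $X^*$ and $X$; $\partial\psi$ is the subdifferential of convex analysis, identified with its graph in $X\times X^*$. The polar set: $K\subset X$ is the closed convex set with $0\in K$ such that $\psi(\xi)=\inf\{\sigma>0:\xi/\sigma\in K\}$ (that is, $K=\{\xi\in X:\psi(\xi)\le1\}$), and $K^*=\{\xi^*\in X^*:\langle\xi^*,\xi\rangle\le1\ \forall\xi\in K\}$. Fitzpatrick function: $f_\alpha(\xi,\xi^* ):=\sup\{\langle\xi^*,\xi_0\rangle-\langle\xi_0^*,\xi_0-\xi\rangle:(\xi_0,\xi_0^* )\in\alpha\}$. Recession function: $f_\alpha^\infty(\xi,\xi^* ):=\sup\{f_\alpha(\xi+x,\xi^*+x^* )-f_\alpha(x,x^* ):(x,x^* )\in D(f_\alpha)\}$, where $D(f_\alpha)=\{f_\alpha<\infty\}$. BV notation: $BV([0,T];X)$ is the space of measurable functions $u:[0,T]\to X$, defined at every $t\in[0,T]$, with finite pointwise total variation. The distributional derivative $du$ is a Radon vector measure on $(0,T)$ of bounded variation; $du=(du)_{\mathrm{ac}}+(du)_{\mathrm{sin}}$ is its Lebesgue decomposition with respect to Lebesgue measure $\mathcal L$, $\|\mu\|$ denotes the variation measure of a vector measure $\mu$, $\dot u_{\mathrm{ac}}$ is the density of $(du)_{\mathrm{ac}}$ with respect to $\mathcal L$, and $\dot u_{\mathrm{sin}}$ is the density of $(du)_{\mathrm{sin}}$ with respect to $\|(du)_{\mathrm{sin}}\|$. The $\psi$-variation is $$\mathrm{Var}_\psi(u;[0,t])=\sup\Big\{\sum_{m=1}^M\psi(u(t_m)-u(t_{m-1})):0=t_0<t_1<\dots<t_M=t\Big\}.$$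 Standing assumptions on the energy $\mathcal E:[0,T]\times X\to(-\infty,+\infty]$, written $\mathcal E_t(u)=\mathcal E(t,u)$; $\partial\mathcal E_t(u)$ denotes the Fréchet subdifferential, i.e. $\xi\in\partial\mathcal E_t(u)$ iff $\mathcal E_t(u)<\infty$ and $\mathcal E_t(v)\ge\mathcal E_t(u)+\langle\xi,v-u\rangle+o(\|v-u\|)$ as $v\to u$: (Lower semicontinuity) the domain of $\mathcal E$ is $[0,T]\times D$ for some $D\subset X$; $u\mapsto\mathcal E_t(u)$ is lower semicontinuous for all $t$; there is $C_0>0$ with $\mathcal E_t(u)\ge C_0$ on $[0,T]\times D$; the graph of $\partial\mathcal E$ is a Borel subset of $[0,T]\times X\times X^*$. (Coercivity) $u\mapsto\sup_{t\in[0,T]}\mathcal E_t(u)$ has compact sublevels. (Time-differentiability) for $u\in D$ the map $t\mapsto\mathcal E_t(u)$ is differentiable with derivative $\partial_t\mathcal E_t(u)$, and $|\partial_t\mathcal E_t(u)|\le C_1\mathcal E_t(u)$ for some $C_1>0$ and all $t\in[0,T]$, $u\in D$. (Weak closedness) if $\xi_n\in\partial\mathcal E_t(u_n)$, $u_n\to u$ in $X$, $\xi_n\rightharpoonup\xi$ in $X^*$, $\partial_t\mathcal E_t(u_n)\to p$ and $\mathcal E_t(u_n)\to E$ in $\mathbb R$, then $\xi\in\partial\mathcal E_t(u)$, $p\le\partial_t\mathcal E_t(u)$ and $E=\mathcal E_t(u)$.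
   Formalization: Added: u is a good representative (u(t) on the segment between its one-sided limits, no jumps at 0 and T), since du on (0,T) ignores point values and the claim fails otherwise; also E_0(u(0)) is finite and ∂_tE_s(u(s)) is integrable on (0,T), else the inequality is void. *)

(* Defs.v *)
From HB Require Import structures.
From mathcomp Require Import all_boot all_order all_algebra.
From mathcomp Require Import all_classical all_reals all_analysis.

Set Implicit Arguments.
Unset Strict Implicit.
Unset Printing Implicit Defensive.

Import Order.TTheory GRing.Theory Num.Theory.
Import numFieldNormedType.Exports.

Local Open Scope classical_set_scope.
Local Open Scope ring_scope.

Section Dual.
Context {R : realType} (X : normedModType R).

Definition is_functional : {pred X -> R^o} :=
  fun f => `[< linear f /\ continuous f >].

Record dual := Dual {
  dual_fun :> X -> R^o ;
  dual_funP : dual_fun \in is_functional }.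

HB.instance Definition _ := [isSub for dual_fun].
HB.instance Definition _ := gen_eqMixin dual.
HB.instance Definition _ := gen_choiceMixin dual.

Lemma is_functional_submod : submod_closed is_functional.
Proof.
split.
  apply/asboolP; split; last by move=> x; exact: cvg_cst.
  by move=> a x y; change ((0 : R) = a * 0 + 0); rewrite mulr0 addr0.
move=> a f g /asboolP[lf cf] /asboolP[lg cg]; apply/asboolP; split.
  move=> b x y.
  change (a * f (b *: x + y) + g (b *: x + y)
          = b * (a * f x + g x) + (a * f y + g y)).
  rewrite lf lg; change (a * (b * f x + f y) + (b * g x + g y)
          = b * (a * f x + g x) + (a * f y + g y)).
  by rewrite !mulrDr !mulrA (mulrC a b) addrACA.
move=> x; apply: cvgD; last exact: cg.
by apply: cvgZr; exact: cf.
Qed.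

HB.instance Definition _ :=
  GRing.isSubmodClosed.Build R _ is_functional is_functional_submod.
HB.instance Definition _ := [SubChoice_isSubLmodule of dual by <:].

Lemma dualP (f : dual) : linear (f : X -> R^o) /\ continuous (f : X -> R^o).
Proof. by apply/asboolP; exact: dual_funP. Qed.

Definition dual_norm (f : dual) : R :=
  sup [set `|f x| | x in [set x : X | `|x| <= 1]].

Lemma dual0 (f : dual) : f 0 = 0.
Proof.
have [lf _] := dualP f; have := lf 1 0 0.
rewrite !scale1r addr0 => /eqP.
by rewrite -subr_eq subrr => /eqP.
Qed.

Lemma dualZ (f : dual) a x : f (a *: x) = a * f x.
Proof.
have [lf _] := dualP f; have := lf a x 0.
by rewrite dual0 !addr0.
Qed.

Lemma dual_has_sup (f : dual) :
  has_sup [set `|f x| | x in [set x : X | `|x| <= 1]].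
Proof.
split; first by exists `|f 0|, 0 => //=; rewrite normr0.
have [_ cf] := dualP f.
have /cvgr0Pnorm_lt : f x @[x --> 0] --> (0 : R^o).
  by rewrite -[X in _ --> X](dual0 f); exact: cf.
move=> /(_ 1 ltr01) /nbhs_norm0P[e /= e0 fe].
exists (2 / e) => _ [x /= x1 <-].
have e2 : 0 < e / 2 by rewrite divr_gt0.
have /fe : `|(e / 2) *: x| < e.
  rewrite normrZ gtr0_norm//; apply: (@le_lt_trans _ _ (e / 2)).
    by rewrite ler_piMr// ltW.
  by rewrite ltr_pdivrMr// ltr_pMr// ltr1n.
by rewrite dualZ normrM gtr0_norm// -ltr_pdivlMl// mulr1 invf_div => /ltW.
Qed.

Lemma dual_norm_ub (f : dual) x : `|x| <= 1 -> `|f x| <= dual_norm f.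
Proof. by move=> x1; apply: ub_le_sup; [case: (dual_has_sup f) | exists x]. Qed.

Lemma dual_norm_le (f : dual) (c : R) :
  (forall x, `|x| <= 1 -> `|f x| <= c) -> dual_norm f <= c.
Proof.
move=> fc; apply: ge_sup; first by case: (dual_has_sup f).
by move=> _ [x /= x1 <-]; exact: fc.
Qed.

Lemma dual_norm_ge0 f : 0 <= dual_norm f.
Proof. by apply: (le_trans _ (@dual_norm_ub f 0 _)); rewrite ?normr0. Qed.

Lemma ler_dual_normD f g : dual_norm (f + g) <= dual_norm f + dual_norm g.
Proof.
apply: dual_norm_le => x x1.
rewrite (le_trans (ler_normD (f x) (g x)))//.
by rewrite lerD ?dual_norm_ub.
Qed.

Lemma dual_normZ_le (l : R) f : dual_norm (l *: f) <= `|l| * dual_norm f.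
Proof.
apply: dual_norm_le => x x1.
by rewrite [leLHS](normrM l (f x)) ler_wpM2l// dual_norm_ub.
Qed.

Lemma dual_normZ (l : R) f : dual_norm (l *: f) = `|l| * dual_norm f.
Proof.
apply/eqP; rewrite eq_le dual_normZ_le/=.
have [->|l0] := eqVneq l 0; first by rewrite normr0 mul0r dual_norm_ge0.
rewrite -ler_pdivlMl ?normr_gt0// -normfV.
by rewrite -[X in dual_norm X <= _](scalerK l0) dual_normZ_le.
Qed.

Lemma dual_norm_eq0 f : dual_norm f = 0 -> f = 0.
Proof.
move=> f0; apply: val_inj; apply/funext => x /=.
have [->|x0] := eqVneq x 0; first exact: dual0.
have n0 : `|x| != 0 by rewrite normr_eq0.
have : `|f (`|x|^-1 *: x)| <= 0.
  by rewrite -f0 dual_norm_ub// normrZ normfV normr_id mulVf.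
by rewrite normr_le0 dualZ mulf_eq0 invr_eq0 (negbTE n0)/= => /eqP.
Qed.

HB.instance Definition _ := @Lmodule_isNormed.Build R dual dual_norm
  ler_dual_normD dual_normZ dual_norm_eq0.

End Dual.

Definition reflexive_space {R : realType} (X : normedModType R) :=
  forall Phi : dual (dual X), exists x : X, forall f : dual X, Phi f = f x.

Definition weak_cvg {R : realType} {V : normedModType R} (v_ : V^nat) (v : V) :=
  forall f : dual V, f (v_ n) @[n --> \oo] --> f v.

(* Bochner integration over a Borel set D of the line with nu D < +oo: simple
   functions are not required to vanish outside a set of finite measure. *)
Section Bochner.
Context {R : realType} {V : normedModType R}.
Variables (nu : {measure set (measurableTypeR R) -> \bar R}) (D : set R).
Implicit Types (s g : R -> V) (v : V).

Definition simple_function {W : choiceType} (s : R -> W) :=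
  finite_set (range s) /\
  forall w, measurable (s @^-1` [set w] : set (measurableTypeR R)).

Definition simple_integral s : V :=
  \sum_(v \in range s) fine (nu (D `&` s @^-1` [set v])) *: v.

Definition strongly_measurable g := exists s_ : nat -> R -> V,
  (forall n, simple_function (s_ n)) /\
  {ae nu, forall t, D t -> s_ n t @[n --> \oo] --> g t}.

Definition bochner_integrable g :=
  strongly_measurable g /\ (\int[nu]_(t in D) `|g t|%:E < +oo)%E.

Definition is_bochner_integral g v :=
  strongly_measurable g /\
  exists s_ : nat -> R -> V,
    [/\ forall n, simple_function (s_ n),
        (\int[nu]_(t in D) `|s_ n t - g t|%:E)%E @[n --> \oo] --> 0%E &
        simple_integral (s_ n) @[n --> \oo] --> v].

End Bochner.

Section VectorMeasure.
Context {R : realType} {V : normedModType R}.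
Implicit Types (D A : set (measurableTypeR R)).
Implicit Types (mu : set (measurableTypeR R) -> V).

(* A vector measure on D is extended by 0 to the Borel sets of the line. *)
Definition vector_measure D mu :=
  (forall A, measurable A -> mu (A `\` D) = 0) /\
  (forall F : (set (measurableTypeR R))^nat,
     (forall n, measurable (F n)) ->
     trivIset setT F ->
     \sum_(0 <= i < n) mu (F i) @[n --> \oo] --> mu (\bigcup_n F n)).

Definition variation_measure mu A : \bar R :=
  ereal_sup [set x | exists n (F : 'I_n -> set (measurableTypeR R)),
    [/\ forall i, measurable (F i),
        trivIset setT F, \bigcup_i F i = A &
        x = (\sum_(i < n) `|mu (F i)|)%:E]].

(* integral over D of a bounded scalar function against a vector measure, by
   uniform approximation with simple functions *)
Definition is_vector_integral D mu (phi : R -> R) (v : V) :=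
  exists s_ : nat -> R -> R,
    [/\ forall n, simple_function (s_ n),
        forall e, 0 < e ->
          \forall n \near \oo, forall t, D t -> `|s_ n t - phi t| <= e &
        \sum_(c \in range (s_ n)) c *: mu (D `&` s_ n @^-1` [set c])
          @[n --> \oo] --> v].

Definition has_density D mu (nu : {measure set (measurableTypeR R) -> \bar R})
    (g : R -> V) :=
  bochner_integrable nu D g /\
  forall A, measurable A -> A `<=` D ->
    is_bochner_integral nu A g (mu A).

End VectorMeasure.

Section BV.
Context {R : realType} {X : normedModType R}.
Implicit Types (T : R) (u : R -> X) (psi : X -> R).

Definition psi_variation psi u (t : R) : \bar R :=
  ereal_sup [set (\sum_(m < size s)
                    psi (u (nth 0 (0 :: s) m.+1) - u (nth 0 (0 :: s) m)))%:E
             | s in [set s : seq R | itv_partition 0 t s]].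

Definition BV T u :=
  strongly_measurable lebesgue_measure `[0, T] u /\
  (psi_variation (fun x : X => `|x|%R) u T < +oo)%E.

Definition test_function T (phi : R -> R) :=
  (forall n t, derivable (derive1n n phi) t 1) /\
  exists a b, [/\ 0 < a, b < T & forall t, phi t != 0 -> a <= t <= b].

Definition distributional_derivative T u
    (du : set (measurableTypeR R) -> X) :=
  forall phi, test_function T phi -> exists x : X,
    is_vector_integral `]0, T[ du phi x /\
    is_bochner_integral lebesgue_measure `]0, T[
      (fun t => derive1 phi t *: u t) (- x).

(* du = du_ac + du_sin is the Lebesgue decomposition of the distributional
   derivative of u, nu is the variation of du_sin, uac and usin are the
   densities of du_ac and du_sin with respect to Lebesgue measure and nu *)
Record derivative_decomposition T u
    (du du_ac du_sin : set (measurableTypeR R) -> X)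
    (nu : {measure set (measurableTypeR R) -> \bar R})
    (uac usin : R -> X) : Prop := DerivativeDecomposition {
  du_measure : vector_measure `]0, T[ du ;
  du_bounded : (variation_measure du setT < +oo)%E ;
  du_derivative : distributional_derivative T u du ;
  du_ac_measure : vector_measure `]0, T[ du_ac ;
  du_sin_measure : vector_measure `]0, T[ du_sin ;
  du_decomposition : forall A : set (measurableTypeR R), measurable A ->
    du A = du_ac A + du_sin A ;
  du_ac_continuous : forall A : set (measurableTypeR R), measurable A ->
    lebesgue_measure A = 0%E -> du_ac A = 0 ;
  du_sin_singular : exists N : set (measurableTypeR R),
    [/\ measurable N, lebesgue_measure N = 0%E &
        forall A : set (measurableTypeR R), measurable A ->
          du_sin (A `\` N) = 0] ;
  nu_variation : forall A : set (measurableTypeR R), measurable A ->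
    nu A = variation_measure du_sin A ;
  uac_density : has_density `]0, T[ du_ac lebesgue_measure uac ;
  usin_density : has_density `]0, T[ du_sin nu usin }.

(* The distributional derivative on ]0, T[ does not see u 0, u T, nor the value
   of u at a jump, whereas psi_variation is pointwise: a function that vanishes
   except at one point has zero derivative but nonzero variation.  Good
   representatives take at each t a value on the segment between the one-sided
   limits, and do not jump at the end points. *)
Definition good_representative T u :=
  [/\ u s @[s --> 0^'+] --> u 0,
      u s @[s --> T^'-] --> u T &
      forall t, 0 < t < T -> exists (l r : X) (theta : R),
        [/\ u s @[s --> t^'-] --> l, u s @[s --> t^'+] --> r,
            0 <= theta <= 1 & u t = (1 - theta) *: l + theta *: r]].

End BV.

Section Convex.
Context {R : realType} {X : normedModType R}.
Implicit Types (psi : X -> R) (alpha : set (X * dual X)).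
Implicit Types (f : X -> dual X -> \bar R).

Definition subdifferential psi : set (X * dual X) :=
  [set p : X * dual X | forall y, psi p.1 + p.2 (y - p.1) <= psi y].

Definition polar (K : set X) : set (dual X) :=
  [set f : dual X | forall x, K x -> f x <= 1].

Definition fitzpatrick alpha (x : X) (x' : dual X) : \bar R :=
  ereal_sup [set (x' p.1 - p.2 (p.1 - x))%:E | p in alpha].

Definition recession f (x : X) (x' : dual X) : \bar R :=
  ereal_sup [set (f (x + p.1)%R (x' + p.2)%R - f p.1 p.2)%E
            | p in [set p : X * dual X | (f p.1 p.2 < +oo)%E]].

Definition frechet_subdifferential (F : X -> \bar R) (u : X) : set (dual X) :=
  [set xi | (F u < +oo)%E /\
    forall e : R, 0 < e -> \forall v \near u,
      (F u + (xi (v - u) - e * `|v - u|)%R%:E <= F v)%E].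

End Convex.

Section Energy.
Context {R : realType} {X : normedModType R}.

(* dtE t u stands for the time derivative of E at (t, u); it is only meaningful
   for t in [0, T] and u in D, and one-sided at the end points *)
Record energy_assumptions (T : R) (D : set X) (E : R -> X -> \bar R)
    (dtE : R -> X -> R) : Prop := EnergyAssumptions {
  energy_gtNy : forall t u, t \in `[0, T] -> (-oo < E t u)%E ;
  energy_domain : forall t u, t \in `[0, T] -> (E t u < +oo)%E <-> D u ;
  energy_lsc : forall t, t \in `[0, T] -> lower_semicontinuous (E t) ;
  energy_lower_bound : exists2 C0 : R, 0 < C0 &
    forall t u, t \in `[0, T] -> D u -> (C0%:E <= E t u)%E ;
  energy_graph_borel : <<s [set U : set (R * X * dual X) | open U] >>
    [set p : R * X * dual X | p.1.1 \in `[0, T] /\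
       frechet_subdifferential (E p.1.1) p.1.2 p.2] ;
  energy_coercive : forall c : R,
    compact [set u | (ereal_sup [set E t u | t in `[0%R, T]] <= c%:E)%E] ;
  energy_differentiable : forall t u, t \in `[0, T] -> D u ->
    (fine (E s u) - fine (E t u)) / (s - t)
      @[s --> within `[0, T] t^'] --> dtE t u ;
  energy_derivative_bound : exists2 C1 : R, 0 < C1 &
    forall t u, t \in `[0, T] -> D u -> (`|dtE t u|%:E <= C1%:E * E t u)%E ;
  energy_weak_closed : forall (t : R) (u_ : X^nat) (xi_ : (dual X)^nat)
      (u : X) (xi : dual X) (p e : R),
    t \in `[0, T] ->
    (forall n, frechet_subdifferential (E t) (u_ n) (xi_ n)) ->
    u_ n @[n --> \oo] --> u ->
    weak_cvg xi_ xi ->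
    dtE t (u_ n) @[n --> \oo] --> p ->
    E t (u_ n) @[n --> \oo] --> e%:E ->
    [/\ frechet_subdifferential (E t) u xi, p <= dtE t u & e%:E = E t u] }.

End Energy.

(* Main.v *)
Require Import Defs.
From HB Require Import structures.
From mathcomp Require Import all_boot all_order all_algebra.
From mathcomp Require Import all_classical all_reals all_analysis.
From mathcomp Require Import measurable_realfun ring lra.

Set Implicit Arguments.
Unset Strict Implicit.
Unset Printing Implicit Defensive.

Import Order.TTheory GRing.Theory Num.Theory.
Import numFieldNormedType.Exports.

Local Open Scope classical_set_scope.
Local Open Scope ring_scope.

(** Why the theorem is true.

    Since psi is sublinear, the Fitzpatrick function of its subdifferential is
    psi (x) when x' lies in the polar set and +oo otherwise, and its recession
    function at (x, 0) is psi (x).  The proof rests on the lower bounds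
    (fitzpatrick_ge, fitzpatrick_pinfty, recession_fitzpatrick_ge).  They hold
    because psi has a supporting functional at every point, by the
    Hahn-Banach theorem, such functionals being continuous because a lower
    semicontinuous sublinear function on a Banach space is dominated by a
    multiple of the norm (Baire).

    The energy inequality at time T bounds the integral of the Fitzpatrick
    function, so that this function is finite almost everywhere: - xi takes
    its values in the polar set (ae_le_of_integral_fin).

    For the second claim it remains to bound the pointwise psi-variation of u
    by the mass m of the measure whose density is psi (uac) with respect to
    Lebesgue measure plus psi (usin) with respect to nu.  Fix f <= psi in the
    dual space.  Jensen's inequality for Bochner integrals
    (bochner_integral_le) gives f (du A) <= m A for every Borel set A.  Testing
    the distributional derivative with a smooth function that rises from 0 to 1
    just after a and falls back just before b turns this into
    f (u (b-) - u (a+)) <= m (]a, b[); a test function that surrounds the point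
    t yields f (u (t+) - u (t-)) <= m {t} (interval_test_le, point_test_le).
    Choosing f that supports psi at the increment replaces f by psi.  A good
    representative takes at t the value that has covered a fraction theta of
    the jump, hence the function N t = m (]0, t[) + theta m {t} dominates the
    increments of u: psi (u b - u a) <= N b - N a, and the sum over a partition
    telescopes (psi_variation_potential).

    All integrals are taken of functions that need not be Borel measurable.
    Below every nonnegative continuous function of a strongly measurable one
    there is a Borel function that is almost everywhere equal to it
    (strongly_measurable_minorant), and integrals of nonnegative functions are
    monotone without measurability (ge0_le_integral_lower); all estimates are
    made on the Borel minorants. *)

(** * Sublinear functionals and the Hahn-Banach theorem *)

Section Sublinear.
Context {R : realType} {V : lmodType R}.
Implicit Types x y : V.

Definition sublinear (q : V -> R) :=
  (forall x y, q (x + y) <= q x + q y) /\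
  (forall (l : R) x, 0 < l -> q (l *: x) = l * q x).

Lemma sublinear0 q : sublinear q -> q 0 = 0.
Proof. by move=> [_ qZ]; have := qZ 2 0 (ltr0Sn R 1); rewrite scaler0; lra. Qed.

Lemma sublinearZ_ge0 q (l : R) x : sublinear q -> 0 <= l -> q (l *: x) = l * q x.
Proof.
move=> sq; rewrite le_eqVlt => /predU1P[<-|l0]; last exact: sq.2.
by rewrite scale0r mul0r sublinear0.
Qed.

Lemma sublinearN_ge q x : sublinear q -> - q (- x) <= q x.
Proof.
by move=> sq; have := sq.1 x (- x); rewrite subrr sublinear0//; lra.
Qed.

(** The largest sublinear function r below q with r (- y) <= - q y.  The infimum
    is finite because q (x + t y) - t q y >= - q (- x). *)
Definition directional_inf (q : V -> R) y x : R :=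
  inf [set q (x + t *: y) - t * q y | t in [set t : R | 0 <= t]].

Lemma directional_inf_le q y x (t : R) : sublinear q -> 0 <= t ->
  directional_inf q y x <= q (x + t *: y) - t * q y.
Proof.
move=> sq t0; apply: inf_lbound; last by exists t.
exists (- q (- x)) => _ [s /= s0 <-].
have := sq.1 (x + s *: y) (- x).
by rewrite addrAC subrr add0r sublinearZ_ge0//; lra.
Qed.

Lemma directional_inf_ge q y x (c : R) :
  (forall t : R, 0 <= t -> c <= q (x + t *: y) - t * q y) ->
  c <= directional_inf q y x.
Proof.
move=> h; apply: lb_le_inf; first by exists (q (x + 0 *: y) - 0 * q y), 0 => /=.
by move=> _ [t /= t0 <-]; exact: h.
Qed.

Lemma directional_inf_sublinear q y :
  sublinear q -> sublinear (directional_inf q y).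
Proof.
move=> sq; split=> [x1 x2|l x l0].
  rewrite -lerBlDl; apply: directional_inf_ge => t t0.
  rewrite lerBlDl -lerBlDr; apply: directional_inf_ge => s s0.
  rewrite lerBlDr (le_trans (directional_inf_le _ _ sq (addr_ge0 t0 s0)))//.
  have := sq.1 (x1 + s *: y) (x2 + t *: y).
  by rewrite addrACA -scalerDl (addrC s t); lra.
apply/eqP; rewrite eq_le; apply/andP; split; last first.
  apply: directional_inf_ge => t t0.
  rewrite -ler_pdivlMl//.
  have tl : 0 <= l^-1 * t by rewrite mulr_ge0// invr_ge0 ltW.
  apply: le_trans (directional_inf_le _ _ sq tl) _.
  rewrite mulrBr -[l^-1 * q _]sq.2 ?invr_gt0// scalerDr !scalerA mulVf ?gt_eqF//.
  by rewrite scale1r mulrA.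
rewrite -ler_pdivrMl//; apply: directional_inf_ge => t t0.
rewrite ler_pdivrMl//.
have tl : 0 <= l * t by rewrite mulr_ge0// ltW.
apply: le_trans (directional_inf_le _ _ sq tl) _.
by rewrite mulrBr -[l * q _]sq.2// scalerDr scalerA mulrA.
Qed.

Lemma directional_inf_self q y x : sublinear q -> directional_inf q y x <= q x.
Proof.
move=> sq; have := @directional_inf_le q y x 0 sq (lexx 0).
by rewrite scale0r addr0 mul0r subr0.
Qed.

Lemma directional_infN q y : sublinear q -> directional_inf q y (- y) <= - q y.
Proof.
move=> sq; have := @directional_inf_le q y (- y) 1 sq ler01.
by rewrite scale1r addNr sublinear0// mul1r add0r.
Qed.

(** Zorn's lemma applies because the pointwise infimum of a chain is sublinear:
    it is finite, the members being bounded below by - p (- x). *)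
Lemma exists_minimal_sublinear p : sublinear p ->
  exists q, [/\ sublinear q, forall x, q x <= p x &
    forall r, sublinear r -> (forall x, r x <= q x) -> r = q].
Proof.
move=> sp.
pose S := {q : V -> R | sublinear q /\ forall x, q x <= p x}.
pose le (q r : S) := `[< forall x, sval r x <= sval q x >].
have [||||q qmax] := @Zorn S le.
- by move=> q; apply/asboolP.
- move=> q r s /asboolP qr /asboolP rs; apply/asboolP => x.
  exact: le_trans (rs x) (qr x).
- move=> [q hq] [r hr] /asboolP/= qr /asboolP/= rq; apply: eq_exist => /=.
  by apply/funext => x; apply/eqP; rewrite eq_le qr rq.
- move=> A Atot.
  have [[q0 Aq0]|A0] := pselect (exists q, A q); last first.
    exists (exist _ p (conj sp (fun x => lexx _))) => q Aq.
    by exfalso; apply: A0; exists q.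
  pose m x := inf [set sval q x | q in A].
  have m_le q x : A q -> m x <= sval q x.
    move=> Aq; apply: inf_lbound; last by exists q.
    exists (- p (- x)) => _ [r Ar <-].
    case: r Ar => r [sr rp] _ /=.
    by rewrite (le_trans _ (sublinearN_ge _ sr))// lerN2.
  have m_ge x c : (forall q, A q -> c <= sval q x) -> c <= m x.
    move=> h; apply: lb_le_inf; first by exists (sval q0 x), q0.
    by move=> _ [q Aq <-]; exact: h.
  have sm : sublinear m.
    split=> [x y|l x l0].
      rewrite -lerBlDl; apply/m_ge => q Aq.
      rewrite lerBlDl -lerBlDr; apply/m_ge => r Ar.
      rewrite lerBlDr.
      (* the chain supplies a single functional below both q and r *)
      have [s [As sq sr]] : exists s, [/\ A s, forall x, sval s x <= sval q x
          & forall x, sval s x <= sval r x].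
        by have [/asboolP h|/asboolP h] := Atot _ _ Aq Ar;
           [exists r|exists q]; split.
      rewrite (le_trans (m_le _ _ As))//.
      by rewrite (le_trans ((svalP s).1.1 x y))// lerD.
    apply/eqP; rewrite eq_le; apply/andP; split.
      rewrite -ler_pdivrMl//; apply/m_ge => q Aq.
      rewrite ler_pdivrMl// -(svalP q).1.2//; exact: m_le.
    apply/m_ge => q Aq; rewrite (svalP q).1.2// ler_pM2l//; exact: m_le.
  have mp x : m x <= p x by exact: le_trans (m_le _ _ Aq0) ((svalP q0).2 x).
  exists (exist _ m (conj sm mp)) => q Aq; apply/asboolP => x /=.
  exact: m_le.
exists (sval q); case: q qmax => q [sq qp] /= qmax; split => // r sr rq.
have rp x : r x <= p x by exact: le_trans (rq x) (qp x).
have /(congr1 sval)// := qmax (exist _ r (conj sr rp)) (asboolT rq).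
Qed.

(** Minimality forces directional_inf q y = q, and t = 1 in the infimum gives the
    reverse of subadditivity. *)
Lemma minimal_sublinear_additive q : sublinear q ->
  (forall r, sublinear r -> (forall x, r x <= q x) -> r = q) ->
  forall x y, q (x + y) = q x + q y.
Proof.
move=> sq qmin x y; apply/eqP; rewrite eq_le sq.1/=.
have <- : directional_inf q y = q.
  apply: qmin; first exact: directional_inf_sublinear.
  by move=> z; exact: directional_inf_self.
have := @directional_inf_le q y x 1 sq ler01.
rewrite scale1r mul1r.
have -> : directional_inf q y = q.
  apply: qmin; first exact: directional_inf_sublinear.
  by move=> z; exact: directional_inf_self.
lra.
Qed.

(** Minimal sublinear functionals are linear, so no extension of partially
    defined functionals is involved.  Starting from directional_inf p x0, which
    is at most - p x0 at - x0, makes the functional attain p at x0. *)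
Lemma hahn_banach_sublinear p x0 : sublinear p ->
  exists f : V -> R, [/\ linear (f : V -> R^o), forall x, f x <= p x & f x0 = p x0].
Proof.
move=> sp.
have [q [sq qp qmin]] :=
  exists_minimal_sublinear (@directional_inf_sublinear p x0 sp).
have qD := minimal_sublinear_additive sq qmin.
have qN x : q (- x) = - q x.
  by have := qD x (- x); rewrite subrr sublinear0//; lra.
have qlep x : q x <= p x by apply: le_trans (qp x) (directional_inf_self _ _ sp).
exists q; split => //.
  move=> a x y; rewrite qD; congr (_ + _).
  have [a0|a0] := leP 0 a; first by rewrite sublinearZ_ge0.
  by rewrite -[a]opprK scaleNr qN sq.2 ?oppr_gt0// [RHS]mulNr.
apply/eqP; rewrite eq_le qlep/= -lerN2 -qN.
exact: le_trans (qp _) (directional_infN _ sp).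
Qed.

End Sublinear.

(** * Continuity of sublinear functions on a Banach space *)

Lemma lipschitz_continuous {R : realType} {V : normedModType R} (k : V -> R)
    (C : R) : 0 < C -> (forall x y, k x <= k y + C * `|x - y|) -> continuous k.
Proof.
move=> C0 kC x; apply/cvgrPdist_lt => e e0; near=> y.
have xy : `|x - y| < e / C.
  by near: y; apply: cvgr_dist_lt => //; rewrite divr_gt0.
have {}xy : C * `|x - y| < e by rewrite mulrC -ltr_pdivlMr.
apply: le_lt_trans xy; rewrite ler_norml.
have := kC x y; have := kC y x; rewrite [`|y - x|]distrC; lra.
Unshelve. all: by end_near. Qed.

Lemma sublinear_continuous {R : realType} {X : normedModType R} (psi : X -> R)
    (C : R) : 0 < C -> sublinear psi -> (forall x, psi x <= C * `|x|) ->
  continuous psi.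
Proof.
move=> C0 sp pC; apply: (lipschitz_continuous C0) => x y.
have := sp.1 (x - y) y; rewrite subrK.
have := pC (x - y); lra.
Qed.

Lemma convex_homogeneous_sublinear {R : realType} {X : normedModType R}
    (psi : X -> R) : convex_function setT psi ->
  (forall (l : R) (x : X), 0 < l -> psi (l *: x) = l * psi x) -> sublinear psi.
Proof.
move=> cpsi hpsi; split; last exact: hpsi.
move=> x y.
have half01 : 0 <= (2^-1 : R) <= 1 by lra.
have /andP[h0 h1] := half01.
have := cpsi (Itv01 h0 h1) x y (mem_set Logic.I) (mem_set Logic.I).
change (psi (2^-1 *: x + (1 - 2^-1) *: y) <=
  2^-1 * psi x + (1 - 2^-1) * psi y -> psi (x + y) <= psi x + psi y).
have -> : 1 - 2^-1 = 2^-1 :> R by field.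
by rewrite -scalerDr hpsi ?invr_gt0//; lra.
Qed.

(** By the Baire category theorem some sublevel of such a function contains a
    ball, and a sublinear function bounded near one point is bounded by a
    multiple of the norm. *)
Lemma lsc_sublinear_bounded {R : realType} (X : completeNormedModType R)
    (p : X -> R) : sublinear p -> lower_semicontinuous (EFin \o p) ->
  exists2 C : R, 0 < C & forall x, p x <= C * `|x|.
Proof.
move=> sp /lower_semicontinuousP lp.
pose O (n : nat) := [set x : X | n%:R < p x].
have [n nd] : exists n, ~ dense (O n).
  apply/existsNP => dO.
  have : dense (\bigcap_n O n).
    apply: Baire => n; split; last exact: dO.
    exact: lp n%:R.
  move=> /(_ setT) [|//|x [_ Ox]]; first by exists 0.
    exact: openT.
  have := Ox (Num.truncn (p x)).+1 Logic.I; rewrite /O/=.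
  by apply/negP; rewrite -leNgt ltW// truncnS_gt.
move/denseNE : nd => [A [[x0 /open_nbhs_nbhs /nbhs_ballP[r /= r0 bxr]] A0]].
pose C0 := n%:R + `|p (- x0)| + 1.
have C00 : 0 < C0 by rewrite ltr_wpDl// addr_ge0.
have pball y : `|y| < r -> p y <= C0.
  move=> yr; have Ay : A (x0 + y).
    by apply: bxr; rewrite -ball_normE /ball_/= opprD addrA subrr sub0r normrN.
  have /negP : ~ O n (x0 + y) by move=> h; have : (A `&` O n) (x0 + y) by [];
    rewrite A0.
  rewrite /O/= -leNgt => pn.
  have := sp.1 (x0 + y) (- x0); rewrite addrAC subrr add0r => h.
  rewrite (le_trans h)// /C0.
  have := ler_norm (p (- x0)); lra.
exists (C0 * (2 / r)); first by rewrite mulr_gt0// divr_gt0.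
move=> y; have [->|y0] := eqVneq y 0; first by rewrite sublinear0// normr0 mulr0.
have n0 : 0 < `|y| by rewrite normr_gt0.
have := pball ((r / 2 / `|y|) *: y).
rewrite normrZ ger0_norm; last by rewrite !divr_ge0// ltW.
rewrite divfK ?gt_eqF// sp.2; last by rewrite !divr_gt0.
move=> /(_ _)/wrap[]; first by lra.
rewrite -ler_pdivlMl ?divr_gt0// => h; rewrite (le_trans h)//.
by rewrite !invf_div mulrC -mulrA le_eqVlt; apply/orP; left; apply/eqP; field; lra.
Qed.

(** * Fitzpatrick and recession functions of a subdifferential *)

Section Dual_lemmas.
Context {R : realType} {X : normedModType R}.
Implicit Types (f g : dual X) (x y : X).

Lemma dualD f x y : f (x + y) = f x + f y.
Proof. by have [lf _] := dualP f; have := lf 1 x y; rewrite !scale1r. Qed.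

Lemma dualN f x : f (- x) = - f x.
Proof. by rewrite -scaleN1r dualZ mulN1r. Qed.

Lemma dualB f x y : f (x - y) = f x - f y.
Proof. by rewrite dualD dualN. Qed.

Lemma dual_le f x : `|f x| <= `|f| * `|x|.
Proof.
have [->|x0] := eqVneq x 0; first by rewrite dual0 !normr0 mulr0.
have n0 : 0 < `|x| by rewrite normr_gt0.
rewrite -ler_pdivrMr//.
have := @dual_norm_ub _ _ f (`|x|^-1 *: x).
rewrite normrZ normfV normr_id mulVf ?gt_eqF// dualZ normrM normfV normr_id.
by rewrite mulrC; exact.
Qed.

Lemma dual_of_bounded (f : X -> R) (C : R) :
  linear (f : X -> R^o) -> (forall x, f x <= C * `|x|) ->
  exists g : dual X, forall x, g x = f x.
Proof.
move=> lf fC.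
have f0 : f 0 = 0.
  have := lf 1 0 0; rewrite !scale1r addr0 => /eqP.
  by rewrite -subr_eq subrr => /eqP.
have fN x : f (- x) = - f x.
  by have := lf (-1) x 0; rewrite !scaleN1r !addr0 f0 addr0.
have fB x y : f (x - y) = f x - f y.
  by have := lf 1 x (- y); rewrite !scale1r fN.
have fC' x : `|f x| <= C * `|x|.
  by rewrite ler_norml fC andbT lerNl -fN (le_trans (fC _))// normrN.
suff cf : continuous (f : X -> R^o) by exists (Dual (asboolT (conj lf cf))).
move=> x; apply/cvgrPdist_lt => e e0.
have C0 : 0 < `|C| + 1 by rewrite ltr_wpDl.
near=> y; rewrite -fB (le_lt_trans (fC' _))//.
have : `|x - y| < e / (`|C| + 1).
  by near: y; apply: cvgr_dist_lt => //; rewrite divr_gt0.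
rewrite ltr_pdivlMr// => h; apply: le_lt_trans h; rewrite mulrC.
by rewrite ler_wpM2l// (le_trans (ler_norm _))// lerDl.
Unshelve. all: by end_near. Qed.

End Dual_lemmas.

Section Fitzpatrick.
Context {R : realType} {X : normedModType R}.
Variables (psi : X -> R) (C : R).
Hypotheses (psi_sub : sublinear psi) (psi_ge0 : forall x, 0 <= psi x)
  (psiC : forall x, psi x <= C * `|x|).
Implicit Types (f : dual X) (x : X).

Lemma supporting_functional x :
  exists f, (forall y, f y <= psi y) /\ f x = psi x.
Proof.
have [f [lf fp fx]] := hahn_banach_sublinear x psi_sub.
have [g gf] := dual_of_bounded lf (fun y => le_trans (fp y) (psiC y)).
by exists g; split => [y|]; rewrite gf.
Qed.

Lemma supporting_functional_subdifferential f x :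
  (forall y, f y <= psi y) -> f x = psi x -> subdifferential psi (x, f).
Proof. by move=> fp fx y /=; rewrite dualB fx addrC subrK. Qed.

(** Elements (0, g) of the subdifferential suffice: they contribute g x, and g
    may be chosen to support psi at x. *)
Lemma fitzpatrick_ge x f :
  ((psi x)%:E <= fitzpatrick (subdifferential psi) x f)%E.
Proof.
have [g [gp gx]] := supporting_functional x.
apply: ereal_sup_ubound; exists (0, g) => /=.
  by apply: supporting_functional_subdifferential; rewrite ?dual0 ?sublinear0.
by rewrite sub0r dualN dual0 sub0r opprK gx.
Qed.

(** A point where f exceeds psi can be rescaled at will, since the
    subdifferential is constant along rays. *)
Lemma fitzpatrick_pinfty x f : ~ (forall y, f y <= psi y) ->
  fitzpatrick (subdifferential psi) x f = +oo%E.
Proof.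
move=> /existsNP[y /negP]; rewrite -ltNge => fy.
have [g [gp gy]] := supporting_functional y.
have d0 : 0 < f y - psi y by rewrite subr_gt0.
apply/eqyP => A A0.
pose l := (A + `|g x|) / (f y - psi y).
have l0 : 0 < l by rewrite divr_gt0// ltr_wpDr.
apply: (@le_trans _ _ (l * (f y - psi y) + g x)%:E).
  rewrite lee_fin divfK ?gt_eqF//.
  by have := ler_norm (- g x); rewrite normrN; lra.
apply: ereal_sup_ubound; exists (l *: y, g) => /=.
  apply: supporting_functional_subdifferential => //.
  by rewrite dualZ psi_sub.2// gy.
by rewrite dualZ dualB dualZ gy; congr EFin; ring.
Qed.

Lemma fitzpatrick00 : fitzpatrick (subdifferential psi) 0 0 = 0%E.
Proof.
apply/eqP; rewrite eq_le; apply/andP; split; last first.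
  by have := fitzpatrick_ge 0 0; rewrite sublinear0.
apply: ge_ereal_sup => _ [[y g] /= gy <-].
have := gy 0; rewrite /= sublinear0// sub0r subr0 dualN => h.
rewrite lee_fin; change (0 - g y <= 0 :> R).
by have := psi_ge0 y; lra.
Qed.

(** The supremum defining the recession function is tested at the origin, where
    the Fitzpatrick function vanishes. *)
Lemma recession_fitzpatrick_ge x :
  ((psi x)%:E <= recession (fitzpatrick (subdifferential psi)) x 0%R)%E.
Proof.
apply: (@le_trans _ _ (fitzpatrick (subdifferential psi) (x + 0)%R (0 + 0)%R
    - fitzpatrick (subdifferential psi) 0%R 0%R)%E).
  by rewrite fitzpatrick00 sube0 !addr0; exact: fitzpatrick_ge.
by apply: ereal_sup_ubound; exists (0, 0) => //=; rewrite fitzpatrick00 ltey.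
Qed.

End Fitzpatrick.

(** * Smooth steps *)

Section SmoothStep.
Context {R : realType}.
Implicit Types (x y : R) (f g : R -> R).

Lemma is_derive_chain f g x (df dg : R) :
  is_derive x (1 : R) f df -> is_derive (f x) (1 : R) g dg ->
  is_derive x (1 : R) (g \o f) (dg * df).
Proof.
move=> [fx <-] [gx <-]; apply: DeriveDef.
  apply/derivable1_diffP; apply: differentiable_comp; exact/derivable1_diffP.
by have := derive1_comp fx gx; rewrite !derive1E.
Qed.

(** The family x^-k exp(-1/x), extended by 0 to the half-line x <= 0, is closed
    under derivation up to linear combinations. *)
Definition flat (k : nat) (x : R) : R :=
  if 0 < x then x^-1 ^+ k * expR (- x^-1) else 0.

Lemma flat_ge0 k x : 0 <= flat k x.
Proof.
rewrite /flat; case: ifP => // x0.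
by rewrite mulr_ge0 ?expR_ge0// exprn_ge0// invr_ge0 ltW.
Qed.

(** The factorial comes from exp y >= y^(k+1) / (k+1)! with y = 1/x.  The bound
    makes flat k continuous at 0 for every k, hence differentiable there, the
    difference quotient of flat k at 0 being flat (k+1). *)
Lemma flat_le k x : flat k x <= (k.+1)`!%:R * `|x|.
Proof.
rewrite /flat; case: ifP => [x0|_]; last by rewrite mulr_ge0.
rewrite expRN ler_pdivrMr ?expR_gt0// gtr0_norm//.
have y0 : 0 <= x^-1 by rewrite invr_ge0 ltW.
have := expR_ge1Dxn k y0 => h.
have {h} : x^-1 ^+ k.+1 / (k.+1)`!%:R <= expR x^-1 by lra.
rewrite ler_pdivrMr ?ltr0n ?fact_gt0// exprS ler_pdivrMl// => h.
by rewrite (le_trans h)// le_eqVlt; apply/orP; left; apply/eqP; ring.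
Qed.

Lemma is_derive_flat k x :
  is_derive x (1 : R) (flat k) (flat k.+2 x - k%:R * flat k.+1 x).
Proof.
have [x0|x0|<-] := ltgtP 0 x; last first.
- rewrite {2 3}/flat ltxx mulr0 subrr.
  have lim0 : (fun h => h^-1 *: ((flat k \o shift 0) (h *: (1 : R)) - flat k 0))
      @ 0^' --> (0 : R).
    apply/cvgr0Pnorm_lt => e e0.
    near=> h.
    have h0 : h != 0 by near: h; exact: nbhs_dnbhs_neq.
    rewrite /= addr0 [h *: _]mulr1 /flat ltxx subr0.
    case: ifP => [hp|_]; last by rewrite scaler0 normr0.
    have -> : h^-1 *: (h^-1 ^+ k * expR (- h^-1)) = flat k.+1 h :> R.
      by rewrite /flat hp [LHS]mulrA -exprS.
    rewrite ger0_norm ?flat_ge0// (le_lt_trans (flat_le _ _))//.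
    rewrite -ltr_pdivlMl ?ltr0n ?fact_gt0//.
    by near: h; apply: dnbhs0_lt; rewrite mulr_gt0// invr_gt0 ltr0n fact_gt0.
  by apply: DeriveDef; [apply/cvg_ex; exists 0|exact: cvg_lim].
- have -> : flat k.+2 x - k%:R * flat k.+1 x = 0.
    by rewrite /flat ltNge ltW//= mulr0 subrr.
  apply: (near_eq_is_derive _ (is_derive_cst (0 : R) x 1)).
  near=> y; rewrite /flat ltNge ltW//.
  by near: y; exact: lt_nbhsl.
- have dV : is_derive x (1 : R) (fun y => y^-1) (- x ^- 2).
    have dx : derivable (id : R -> R) x 1 by exact: derivable_id.
    apply: DeriveDef; first by apply: derivableV => //; rewrite gt_eqF.
    by rewrite deriveV ?gt_eqF// derive_id [LHS]mulr1.
  have dE : is_derive x (1 : R) (expR \o (fun y => - y^-1))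
      (expR (- x^-1) * x ^- 2).
    apply: is_derive_chain.
    by have := is_deriveN dV; rewrite opprK.
  have dX : is_derive x (1 : R) (fun y => y^-1 ^+ k)
      (k%:R * x^-1 ^+ k.-1 * - x ^- 2).
    by rewrite -(exprfctE (fun y => y^-1)); exact: is_deriveX.
  have dM := is_deriveM dX dE.
  apply: (@near_eq_is_derive _ _ _ ((fun y => y^-1 ^+ k) * (expR \o (fun y => - y^-1)))).
    by near=> y; rewrite /flat ifT//; near: y; exact: lt_nbhsr.
  apply: trigger_derive dM _.
  rewrite /flat x0 /= /GRing.scale/=.
  rewrite -!exprVn; move: (x^-1) (expR (- x^-1)) => y z.
  by case: k {dX} => [|k] /=; [ring|rewrite !exprS; ring].
Unshelve. all: by end_near. Qed.

(** An inductive class of functions stable under derivation: all its members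
    are infinitely differentiable. *)
Inductive flat_generated : (R -> R) -> Prop :=
| flat_generated_cst c : flat_generated (fun=> c)
| flat_generated_flat k a b : flat_generated (fun x => flat k (a * x + b))
| flat_generatedD f g : flat_generated f -> flat_generated g ->
    flat_generated (fun x => f x + g x)
| flat_generatedM f g : flat_generated f -> flat_generated g ->
    flat_generated (fun x => f x * g x)
| flat_generatedV f : flat_generated f -> (forall x, f x != 0) ->
    flat_generated (fun x => (f x)^-1).

Lemma flat_generated_derive f : flat_generated f ->
  exists2 g, flat_generated g & forall x, is_derive x (1 : R) f (g x).
Proof.
elim=> {f} [c|k a b|f g _ [f' gf' df] _ [g' gg' dg]
           |f g gf [f' gf' df] gg [g' gg' dg]|f gf [f' gf' df] f0].
- exists (fun=> 0); first exact: flat_generated_cst.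
  by move=> x; exact: is_derive_cst.
- exists (fun x => (flat k.+2 (a * x + b) + - k%:R * flat k.+1 (a * x + b)) * a).
    apply: flat_generatedM; last exact: flat_generated_cst.
    apply: flat_generatedD; first exact: flat_generated_flat.
    apply: flat_generatedM; [exact: flat_generated_cst|exact: flat_generated_flat].
  move=> x; rewrite mulNr.
  have da : is_derive x (1 : R) (fun x => a * x + b) a.
    have d := is_deriveD (is_deriveM (is_derive_cst a x 1) (is_derive_id x 1))
      (is_derive_cst b x 1).
    by apply: (@trigger_derive _ (fun x => a * x + b) _ _ _ d); rewrite /GRing.scale/=; ring.
  by have := is_derive_chain da (is_derive_flat k (a * x + b)).
- exists (fun x => f' x + g' x); first exact: flat_generatedD.
  by move=> x; exact: is_deriveD.
- exists (fun x => f x * g' x + g x * f' x).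
    by apply: flat_generatedD; exact: flat_generatedM.
  by move=> x; exact: is_deriveM.
- exists (fun x => -1 * ((f x)^-1 * (f x)^-1) * f' x).
    apply: flat_generatedM => //; apply: flat_generatedM; first exact: flat_generated_cst.
    by apply: flat_generatedM; exact: flat_generatedV.
  move=> x; have [dfx <-] := df x.
  apply: DeriveDef; first exact: derivableV.
  by rewrite deriveV// mulN1r expr2 invfM.
Qed.

Lemma flat_generated_derive1 f : flat_generated f ->
  flat_generated (derive1 f) /\ forall x, derivable f x 1.
Proof.
move=> /flat_generated_derive[g gg dfg]; split=> [|x]; last by case: (dfg x).
suff -> : derive1 f = g by [].
by apply/funext => x; rewrite derive1E; case: (dfg x).
Qed.

Lemma flat_generated_smooth f : flat_generated f ->
  forall n x, derivable (derive1n n f) x 1.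
Proof.
move=> gf n; suff /flat_generated_derive1[] : flat_generated (derive1n n f) by [].
by elim: n => [//|n /flat_generated_derive1[]].
Qed.

(** A smooth nondecreasing function that is 0 up to p and 1 from p + e on.  The
    affine arguments are written in the form a x + b of flat_generated. *)
Definition smooth_step (p e x : R) : R :=
  flat 0 (e^-1 * x + - (e^-1 * p)) /
  (flat 0 (e^-1 * x + - (e^-1 * p)) + flat 0 (- e^-1 * x + (1 + e^-1 * p))).

Lemma flat0_lt x : 0 < x -> 0 < flat 0 x.
Proof. by move=> x0; rewrite /flat x0 mul1r expR_gt0. Qed.

Lemma flat0_eq0 x : x <= 0 -> flat 0 x = 0.
Proof. by move=> x0; rewrite /flat ltNge x0. Qed.

Lemma flat0_homo x y : x <= y -> flat 0 x <= flat 0 y.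
Proof.
move=> xy; have [x0|x0] := leP x 0; first by rewrite flat0_eq0// flat_ge0.
rewrite /flat x0 (lt_le_trans x0 xy) !expr0 !mul1r ler_expR lerN2.
by rewrite lef_pV2// posrE// (lt_le_trans x0 xy).
Qed.

Lemma smooth_step_den p e x :
  0 < flat 0 (e^-1 * x + - (e^-1 * p)) + flat 0 (- e^-1 * x + (1 + e^-1 * p)).
Proof.
have [h|h] := ltP 0 (e^-1 * x + - (e^-1 * p)).
  by rewrite ltr_pwDl ?flat_ge0// flat0_lt.
by rewrite ltr_wpDl ?flat_ge0// flat0_lt//; lra.
Qed.

Lemma smooth_step_generated p e : flat_generated (smooth_step p e).
Proof.
apply: flat_generatedM; first exact: flat_generated_flat.
apply: flat_generatedV => [|x]; last by rewrite gt_eqF// smooth_step_den.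
by apply: flat_generatedD; exact: flat_generated_flat.
Qed.

Lemma smooth_step_ge0 p e x : 0 <= smooth_step p e x.
Proof. by rewrite divr_ge0 ?flat_ge0// ltW// smooth_step_den. Qed.

Lemma smooth_step_le1 p e x : smooth_step p e x <= 1.
Proof. by rewrite ler_pdivrMr ?smooth_step_den// mul1r lerDl flat_ge0. Qed.

Lemma smooth_step_eq0 p e x : 0 < e -> x <= p -> smooth_step p e x = 0.
Proof.
move=> e0 xp; rewrite /smooth_step flat0_eq0 ?mul0r//.
by rewrite -mulrBr pmulr_rle0 ?invr_gt0// subr_le0.
Qed.

Lemma smooth_step_eq1 p e x : 0 < e -> p + e <= x -> smooth_step p e x = 1.
Proof.
move=> e0 xp; have := smooth_step_den p e x; rewrite /smooth_step.
have h : - e^-1 * x + (1 + e^-1 * p) <= 0.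
  rewrite -[1](@mulVf _ e) ?gt_eqF// mulNr -mulrN -!mulrDr.
  by rewrite pmulr_rle0 ?invr_gt0//; lra.
by rewrite (flat0_eq0 h) addr0 => ?; rewrite divff// gt_eqF.
Qed.

Lemma smooth_step_homo p e x y : 0 < e -> x <= y ->
  smooth_step p e x <= smooth_step p e y.
Proof.
move=> e0 xy; rewrite ler_pdivrMr ?smooth_step_den// mulrAC.
rewrite ler_pdivlMr ?smooth_step_den// !mulrDr mulrC lerD2l.
rewrite mulrC [leRHS]mulrC.
have ei : 0 < e^-1 by rewrite invr_gt0.
apply: ler_pM; rewrite ?flat_ge0//; apply: flat0_homo.
  by rewrite lerD2r !mulNr lerN2 ler_pM2l.
by rewrite lerD2r ler_pM2l.
Qed.

Lemma smooth_step_antitone p q e x : 0 < e -> p <= q ->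
  smooth_step q e x <= smooth_step p e x.
Proof.
move=> e0 pq; have -> : smooth_step q e x = smooth_step p e (x - (q - p)).
  by rewrite /smooth_step; congr (_ / (_ + _)); congr (flat 0 _); lra.
by apply: smooth_step_homo => //; lra.
Qed.

(** All difference quotients of a nondecreasing function are nonnegative. *)
Lemma nondecreasing_derive1_ge0 f x : {homo f : y z / y <= z} ->
  derivable f x 1 -> 0 <= derive1 f x.
Proof.
move=> hf df; rewrite derive1E; apply: limr_ge; first exact: df.
near=> h; have h0 : h != 0 by near: h; exact: nbhs_dnbhs_neq.
rewrite /= [h *: _]mulr1; have [hn|hp|h00] := ltgtP h 0.
- rewrite -[_ *: _]mulrNN; apply: mulr_ge0; rewrite oppr_ge0.
    by rewrite invr_le0 ltW.
  by rewrite subr_le0 hf// gerDr ltW.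
- apply: mulr_ge0; first by rewrite invr_ge0 ltW.
  by rewrite subr_ge0 hf// lerDr ltW.
- by rewrite h00 eqxx in h0.
Unshelve. all: by end_near. Qed.

Lemma smooth_step_derive_ge0 p e x : 0 < e -> 0 <= derive1 (smooth_step p e) x.
Proof.
move=> e0; apply: nondecreasing_derive1_ge0 => [y z|].
  exact: smooth_step_homo.
exact: (flat_generated_derive1 (smooth_step_generated p e)).2.
Qed.

Lemma smooth_step_derive_eq0 p e x : 0 < e -> ~~ (p <= x <= p + e) ->
  derive1 (smooth_step p e) x = 0.
Proof.
move=> e0; rewrite negb_and -!ltNge derive1E => /orP[xp|xp].
  rewrite (@near_eq_derive _ R^o R^o _ (cst 0)) ?derive_cst//.
  near=> y; apply: smooth_step_eq0 => //; apply: ltW.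
  by near: y; exact: lt_nbhsl.
rewrite (@near_eq_derive _ R^o R^o _ (cst 1)) ?derive_cst//.
near=> y; apply: smooth_step_eq1 => //; apply: ltW.
by near: y; exact: lt_nbhsr.
Unshelve. all: by end_near. Qed.

End SmoothStep.

Section FTC.
Context {R : realType}.
Implicit Types (G : R -> R).

Lemma flat_generated_FTC G (a b : R) : a < b -> flat_generated G ->
  lebesgue_measure.-integrable `]a, b[ (EFin \o derive1 G) /\
  (\int[lebesgue_measure]_(t in `]a, b[) (derive1 G t)%:E = (G b - G a)%:E)%E.
Proof.
move=> ab gG; have [gdG dG] := flat_generated_derive1 gG.
have [_ ddG] := flat_generated_derive1 gdG.
have cont (F : R -> R) : (forall x, derivable F x 1) -> continuous F.
  by move=> dF x; apply/differentiable_continuous/derivable1_diffP.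
have Icc : lebesgue_measure.-integrable `[a, b] (EFin \o derive1 G).
  apply: continuous_compact_integrable; first exact: segment_compact.
  by apply: continuous_subspaceT; exact: cont.
split; first by apply: integrableS Icc => //; exact: subset_itv_oo_cc.
have mdG A : measurable_fun A (EFin \o derive1 G).
  apply/measurable_EFinP; apply: measurable_funTS.
  by apply: continuous_measurable_fun; exact: cont.
rewrite integral_itv_bndo_bndc// integral_itv_obnd_cbnd//.
apply: (continuous_FTC2 ab) => [||x _]; last by [].
- by apply: continuous_subspaceT; exact: cont.
- split=> [x _||]; first exact: dG.
    by apply: cvg_at_right_filter; exact: (cont G dG a).
  by apply: cvg_at_left_filter; exact: (cont G dG b).
Qed.

Lemma derive1_linear_combination (g h : R -> R) (al be t : R) :
  derivable g t 1 -> derivable h t 1 ->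
  derive1 (fun s => al * g s + be * h s) t = al * derive1 g t + be * derive1 h t.
Proof.
move=> /derivableP dg /derivableP dh; rewrite !derive1E.
exact: (@derive_val _ _ _ _ _ _ _ (is_deriveD (is_deriveZ al dg) (is_deriveZ be dh))).
Qed.

Definition step_combination (p q e al be t : R) : R :=
  al * smooth_step p e t + be * smooth_step q e t.

Lemma step_combination_generated p q e al be :
  flat_generated (step_combination p q e al be).
Proof.
by apply: flat_generatedD; apply: flat_generatedM;
  [exact: flat_generated_cst|exact: smooth_step_generated
  |exact: flat_generated_cst|exact: smooth_step_generated].
Qed.

Lemma step_combination_derive1 p q e al be t :
  derive1 (step_combination p q e al be) t =
  al * derive1 (smooth_step p e) t + be * derive1 (smooth_step q e) t.
Proof.
exact: (derive1_linear_combination _ _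
  ((flat_generated_derive1 (smooth_step_generated p e)).2 t)
  ((flat_generated_derive1 (smooth_step_generated q e)).2 t)).
Qed.

End FTC.

(** * Integration of strongly measurable functions *)

Section Measurability.
Context {R : realType}.
Implicit Types (nu : {measure set (measurableTypeR R) -> \bar R}).
Implicit Types (A D : set (measurableTypeR R)).
Local Notation B := (measurableTypeR R).

(** Instance resolution does not unfold measurableTypeR to reach the filter
    structure of a general measurable type. *)
#[global] Instance ae_filter_line nu : Filter (almost_everywhere nu).
Proof. exact: ae_filter_ringOfSetsType. Qed.

(** Integrals of nonnegative functions are suprema over simple minorants, hence
    are monotone even when the functions are not measurable. *)
Lemma ge0_le_integral_lower nu D (f1 f2 : B -> \bar R) :
  (forall t, D t -> (0 <= f1 t)%E) -> (forall t, D t -> (f1 t <= f2 t)%E) ->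
  (\int[nu]_(t in D) f1 t <= \int[nu]_(t in D) f2 t)%E.
Proof.
move=> f10 f12.
have f20 t : D t -> (0 <= f2 t)%E by move=> Dt; exact: le_trans (f10 t Dt) (f12 t Dt).
rewrite !ge0_integralE//; apply: le_ereal_sup => _ [h /= hf <-]; exists h => //= t.
rewrite (le_trans (hf t))// !patchE; case: ifPn => // /set_mem; exact: f12.
Qed.

Lemma simple_preimage_measurable {W : choiceType} (s : R -> W) (C : set W) :
  simple_function s -> measurable (s @^-1` C : set B).
Proof.
move=> [fs ms].
have -> : s @^-1` C = \bigcup_(w in range s `&` C) s @^-1` [set w].
  apply/seteqP; split=> [t Ct|t [w [_ Cw] /= stw]]; last by rewrite /= stw.
  by exists (s t).
by apply: fin_bigcup_measurable => [|w _]; [exact: finite_setIl|exact: ms].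
Qed.

Lemma simple_comp_measurable {W : choiceType} (s : R -> W) (k : W -> R) :
  simple_function s -> measurable_fun setT (k \o s : B -> R).
Proof.
move=> ss _ Y mY; rewrite setTI.
exact: (simple_preimage_measurable (k @^-1` Y) ss).
Qed.

Lemma simple_pair {W1 W2 : choiceType} (s1 : R -> W1) (s2 : R -> W2) :
  simple_function s1 -> simple_function s2 ->
  simple_function (fun t => (s1 t, s2 t)).
Proof.
move=> [fs1 ms1] [fs2 ms2]; split.
  apply: (@sub_finite_set _ _ (range s1 `*` range s2)); last exact: finite_setX.
  by move=> _ [t _ <-]; split => /=; exists t.
move=> [w1 w2].
have -> : (fun t => (s1 t, s2 t)) @^-1` [set (w1, w2)] =
    s1 @^-1` [set w1] `&` s2 @^-1` [set w2].
  by apply/seteqP; split=> t /= => [[-> ->]|[-> ->]].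
exact: measurableI.
Qed.

(** An almost everywhere limit of measurable functions need not be measurable;
    it is replaced by 0 on the exceptional null set. *)
Lemma ae_measurable_minorant nu A (f : R -> R) (f_ : nat -> R -> R) :
  measurable A -> (forall t, A t -> 0 <= f t) ->
  (forall n, measurable_fun setT (f_ n : B -> R)) ->
  {ae nu, forall t, A t -> f_ n t @[n --> \oo] --> f t} ->
  exists p : R -> R, [/\ measurable_fun setT (p : B -> R), forall t, 0 <= p t,
    forall t, A t -> p t <= f t & {ae nu, forall t, A t -> p t = f t}].
Proof.
move=> mA f0 mf [N [mN N0 hN]].
have cN t : (A `\` N) t -> f_ n t @[n --> \oo] --> f t.
  move=> [At Nt]; have := contra_not (hN t) Nt.
  by move=> /contrapT; exact.
exists (f \_ (A `\` N)); split.
- apply/(measurable_restrictT _ _).1; first exact: measurableD.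
  apply: (measurable_fun_cvg _ cN) => n.
  exact: measurable_funS (mf n).
- by move=> t; rewrite patchE; case: ifPn => // /set_mem[/f0].
- by move=> t At; rewrite patchE; case: ifPn => // _; exact: f0.
- exists N; split => // t /= /not_implyP[At]; apply: contra_notP => Nt.
  by rewrite patchE mem_set.
Qed.

Lemma strongly_measurable_minorant {V : normedModType R} nu A (g : R -> V)
    (k : V -> R) : measurable A -> strongly_measurable nu A g ->
  continuous k -> (forall v, 0 <= k v) ->
  exists p : R -> R, [/\ measurable_fun setT (p : B -> R), forall t, 0 <= p t,
    forall t, A t -> p t <= k (g t) & {ae nu, forall t, A t -> p t = k (g t)}].
Proof.
move=> mA [s_ [ss sg]] ck k0.
apply: (@ae_measurable_minorant nu A (k \o g) (fun n => k \o s_ n)) => // [t _|n|].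
- exact: k0.
- exact: (simple_comp_measurable k (ss n)).
apply: filterS sg => t h At.
by apply: continuous_cvg; [exact: ck|exact: h].
Qed.

(** The distance to a simple function is not a function of g alone, but still an
    almost everywhere limit of functions of simple functions. *)
Lemma strongly_measurable_dist {V : normedModType R} nu A (g s : R -> V) :
  measurable A -> strongly_measurable nu A g -> simple_function s ->
  exists q : R -> R, [/\ measurable_fun setT (q : B -> R), forall t, 0 <= q t,
    forall t, A t -> q t <= `|s t - g t| &
    {ae nu, forall t, A t -> q t = `|s t - g t|}].
Proof.
move=> mA [s_ [ss_ sg]] ss.
apply: (@ae_measurable_minorant nu A (fun t => `|s t - g t|)
  (fun n t => `|s t - s_ n t|)) => //.
  move=> n.
  exact: (simple_comp_measurable (fun w => `|w.1 - w.2|) (simple_pair ss (ss_ n))).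
apply: filterS sg => t h At.
by apply: cvg_norm; apply: cvgB; [exact: cvg_cst|exact: h].
Qed.

Lemma ae_le_integral nu D (f g : B -> \bar R) : measurable D ->
  nu.-integrable D f -> nu.-integrable D g ->
  {ae nu, forall t, D t -> (f t <= g t)%E} ->
  (\int[nu]_(t in D) f t <= \int[nu]_(t in D) g t)%E.
Proof.
move=> mD If Ig [N [mN N0 hN]].
rewrite (negligible_integral mN)// [leRHS](negligible_integral mN)//.
have mDN : measurable (D `\` N) by exact: measurableD.
apply: le_integral => //.
- by apply: integrableS If => //; exact: subDsetl.
- by apply: integrableS Ig => //; exact: subDsetl.
- move=> t /set_mem[Dt Nt]; have := contra_not (hN t) Nt.
  by move=> /contrapT; exact.
Qed.

Lemma integrable_cst_finite nu D (c : R) : measurable D -> (nu D < +oo)%E ->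
  nu.-integrable D (cst c%:E).
Proof.
move=> mD Doo; apply/integrableP; split; first exact: measurable_cst.
by rewrite integral_cst// lte_mul_pinfty.
Qed.

Lemma dual_sum {V : normedModType R} (f : dual V) (I : Type) (r : seq I)
  (F : I -> V) : f (\sum_(i <- r) F i) = \sum_(i <- r) f (F i).
Proof. exact: (big_morph f (dualD f) (dual0 f)). Qed.

(** On each level set of s the left-hand side is the integral of a constant.  The
    finiteness of nu A matters because the integral of a simple function
    discards the level sets of infinite measure. *)
Lemma simple_integral_le {V : normedModType R} nu A (s : R -> V) (f : dual V)
    (k : R -> R) : measurable A -> (nu A < +oo)%E -> simple_function s ->
  nu.-integrable A (EFin \o k) -> {ae nu, forall t, A t -> f (s t) <= k t} ->
  ((f (simple_integral nu A s))%:E <= \int[nu]_(t in A) (k t)%:E)%E.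
Proof.
move=> mA Aoo [fs ms] Ik sk.
pose F v : set B := A `&` s @^-1` [set v].
have mF v : measurable (F v) by exact: measurableI.
have FA v : F v `<=` A by exact: subIsetl.
have UF : \big[setU/set0]_(v <- finmap.enum_fset (fset_set (range s))) F v = A.
  rewrite bigsetU_fset_set//; apply/seteqP; split=> [t [v _ /FA]//|t At].
  by exists (s t) => //; exists t.
rewrite /simple_integral fsbig_finite// dual_sum -{2}UF integral_bigsetU_EFin//; first last.
- rewrite UF; exact: measurable_int Ik.
- by move=> v w _ _ [t [[_ /= <-] [_ /= <-]]].
rewrite -sumEFin; apply: lee_sum => v _.
have Fv : (nu (F v) < +oo)%E.
  by apply: le_lt_trans Aoo; apply: le_measure; rewrite ?inE.
rewrite dualZ mulrC EFinM fineK; last by rewrite ge0_fin_numE.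
rewrite -/(F v) -integral_cst//; apply: ae_le_integral => //.
- exact: integrable_cst_finite.
- exact: integrableS Ik.
- apply: filterS sk => t h [At /= stv].
  by rewrite /= lee_fin -stv; exact: h.
Qed.

(** Jensen's inequality for a continuous linear functional, in the form that
    lets the integrand be any integrable majorant of f o g. *)
Lemma bochner_integral_le {V : normedModType R} nu A (g : R -> V) (v : V)
    (f : dual V) (h : R -> R) : measurable A -> (nu A < +oo)%E ->
  is_bochner_integral nu A g v -> nu.-integrable A (EFin \o h) ->
  {ae nu, forall t, A t -> f (g t) <= h t} ->
  ((f v)%:E <= \int[nu]_(t in A) (h t)%:E)%E.
Proof.
move=> mA Aoo [sg [s_ [ss I0 sv]]] Ih gh.
pose I n := (\int[nu]_(t in A) `|s_ n t - g t|%:E)%E.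
have Hfin : (\int[nu]_(t in A) (h t)%:E)%E \is a fin_num by exact: integrable_fin_num.
rewrite -(fineK Hfin) lee_fin.
set H := fine _.
have key n : (I n < +oo)%E ->
    f (simple_integral nu A (s_ n)) <= H + `|f| * fine (I n).
  move=> In.
  have [q [mq q0 qle qae]] := strongly_measurable_dist mA sg (ss n).
  have Iq_le : (\int[nu]_(t in A) (q t)%:E <= I n)%E.
    apply: ge0_le_integral_lower => t At; rewrite lee_fin//; exact: qle.
  have Iq : nu.-integrable A (EFin \o q).
    apply/integrableP; split.
      by apply/measurable_EFinP; exact: measurable_funS mq.
    under eq_integral do rewrite /= ger0_norm//.
    exact: le_lt_trans In.
  have Ifq : nu.-integrable A (EFin \o (fun t => `|f| * q t)).
    exact: (integrableZl mA `|f| Iq).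
  (* f (s n) <= f g + |f| |s n - g|, the last norm being replaced by q *)
  have fs_le : {ae nu, forall t, A t -> f (s_ n t) <= h t + `|f| * q t}.
    apply: filterS2 gh qae => t ght qt At.
    rewrite -[s_ n t](subrK (g t)) dualD addrC lerD ?ght// qt//.
    exact: le_trans (ler_norm _) (dual_le _ _).
  have := simple_integral_le mA Aoo (ss n) (integrableD mA Ih Ifq) fs_le.
  under eq_integral do rewrite EFinD.
  rewrite integralD//.
  under [X in (_ + X)%E]eq_integral do rewrite EFinM.
  rewrite integralZl// -(fineK Hfin) -/H => hle.
  rewrite -lee_fin (le_trans hle)// EFinD leeD2l// EFinM fineK.
    by rewrite lee_wpmul2l// lee_fin.
  by rewrite ge0_fin_numE// integral_ge0// => t _; rewrite lee_fin.
have I0' : fine (I n) @[n --> \oo] --> (0 : R) by exact: fine_cvg.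
have lim : H + `|f| * fine (I n) - f (simple_integral nu A (s_ n)) @[n --> \oo]
    --> H + `|f| * 0 - f v.
  apply: cvgB; last first.
    exact: (cvg_comp _ _ sv ((dualP f).2 v)).
  by apply: cvgD; [exact: cvg_cst|apply: cvgMr].
have /fine_cvgP[hfin _] := I0.
have : 0 <= H + `|f| * 0 - f v.
  apply: (cvgr_to_ge lim); apply: filterS hfin => n hn.
  rewrite subr_ge0; apply: key; rewrite -ge0_fin_numE//.
  by apply: integral_ge0 => t _; rewrite lee_fin.
by rewrite mulr0 addr0 subr_ge0.
Qed.

End Measurability.

(** * Vector measures *)

Section VectorMeasures.
Context {R : realType}.
Local Notation B := (measurableTypeR R).
Implicit Types (nu : {measure set B -> \bar R}) (A D I : set B).

Lemma measure_fin (mu : {measure set B -> \bar R}) (A : set B) :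
  (mu setT < +oo)%E -> measurable A -> mu A \is a fin_num.
Proof.
move=> muT mA; rewrite ge0_fin_numE// (le_lt_trans _ muT)//.
by apply: le_measure; rewrite ?inE.
Qed.

Lemma density_measure_exists nu D (p : R -> R) : measurable D ->
  measurable_fun setT (p : B -> R) -> (forall t, 0 <= p t) ->
  exists m : {measure set B -> \bar R},
    forall A, m A = (\int[nu]_(t in A `&` D) (p t)%:E)%E.
Proof.
move=> mD mp p0.
pose dens A := (\int[nu]_(t in A `&` D) (p t)%:E)%E.
have dens0 : dens set0 = 0%E by rewrite /dens set0I integral_set0.
have dens_ge0 A : (0 <= dens A)%E.
  by apply: integral_ge0 => t _; rewrite lee_fin.
have dens_sigma : semi_sigma_additive dens.
  move=> F mF tF mUF; rewrite /dens; apply: cvg_toP.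
    apply: ereal_nondecreasing_is_cvgn => m n mn.
    by apply: lee_sum_nneg_natr => // k _ _; exact: dens_ge0.
  rewrite setI_bigcupl ge0_integral_bigcup//=.
  - by move=> k; exact: measurableI.
  - by apply/measurable_EFinP; exact: measurable_funS mp.
  - by move=> t _; rewrite lee_fin.
  - exact: trivIset_setIr.
pose mix := isMeasure.Build _ B R dens dens0 dens_ge0 dens_sigma.
pose m : {measure set B -> \bar R} := HB.pack dens mix.
by exists m.
Qed.

Lemma density_sum_measure_exists nu1 nu2 D (p1 p2 : R -> R) : measurable D ->
  measurable_fun setT (p1 : B -> R) -> (forall t, 0 <= p1 t) ->
  measurable_fun setT (p2 : B -> R) -> (forall t, 0 <= p2 t) ->
  exists m : {measure set B -> \bar R}, forall A,
    m A = (\int[nu1]_(t in A `&` D) (p1 t)%:E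
           + \int[nu2]_(t in A `&` D) (p2 t)%:E)%E.
Proof.
move=> mD mp1 p10 mp2 p20.
have [m1 m1E] := density_measure_exists nu1 mD mp1 p10.
have [m2 m2E] := density_measure_exists nu2 mD mp2 p20.
exists (measure_add m1 m2) => A; transitivity (m1 A + m2 A)%E.
  exact: measure_addE.
by rewrite m1E m2E.
Qed.

Lemma simple_measure_sum {W : choiceType} (m : {measure set B -> \bar R})
    (s : R -> W) A : (m setT < +oo)%E -> measurable A -> simple_function s ->
  \sum_(w <- finmap.enum_fset (fset_set (range s))) fine (m (A `&` s @^-1` [set w]))
    = fine (m A).
Proof.
move=> moo mA [fs ms].
have mF w : measurable (A `&` s @^-1` [set w]) by exact: measurableI.
have mfin (F : set B) : measurable F -> m F \is a fin_num by exact: measure_fin.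
have -> : m A = (\sum_(w \in range s) m (A `&` s @^-1` [set w]))%E.
  rewrite -content_fin_bigcup//; last 2 first.
  - by move=> v w _ _ [t [[_ /= <-] [_ /= <-]]].
  - exact: fin_bigcup_measurable.
  congr (m _); apply/seteqP; split=> [t At|t [w _ []]//].
  by exists (s t) => //; exists t.
rewrite fsbig_finite//.
rewrite [in RHS](eq_bigr (fun w => (fine (m (A `&` s @^-1` [set w])))%:E)) ?sumEFin//.
by move=> w _; rewrite fineK// mfin.
Qed.

Section Additivity.
Context {V : normedModType R}.
Variables (D : set B) (mu : set B -> V).
Hypothesis mu_measure : vector_measure D mu.

Lemma vector_measure0 : mu set0 = 0.
Proof. by have := mu_measure.1 set0 measurable0; rewrite set0D. Qed.

Lemma vector_measureU A1 A2 : measurable A1 -> measurable A2 ->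
  A1 `&` A2 = set0 -> mu (A1 `|` A2) = mu A1 + mu A2.
Proof.
move=> m1 m2 A12.
have mF n : measurable (bigcup2 A1 A2 n).
  by case: n => [|[|n]]; [exact: m1|exact: m2|exact: measurable0].
have := mu_measure.2 _ mF; rewrite bigcup2E => /(_ _)/wrap[].
  by rewrite -trivIset_bigcup2.
move=> h; apply/esym; apply: cvg_unique h => //.
apply: cvg_near_cst; exists 2%N => //= n /= n2.
rewrite -(subnK n2) big_mkord addn2 2!big_ord_recl/= big1 ?addr0//.
by move=> i _; rewrite vector_measure0.
Qed.

End Additivity.

(** The singular part is the restriction of mu to the null set that carries it,
    hence its variation is bounded by that of mu. *)
Lemma singular_part_finite {V : normedModType R} D
    (mu mu_ac mu_sin : set B -> V) nu : measurable D ->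
  vector_measure D mu_sin -> (variation_measure mu setT < +oo)%E ->
  (forall A, measurable A -> mu A = mu_ac A + mu_sin A) ->
  (forall A, measurable A -> lebesgue_measure A = 0%E -> mu_ac A = 0) ->
  (exists N : set B, [/\ measurable N, lebesgue_measure N = 0%E &
     forall A, measurable A -> mu_sin (A `\` N) = 0]) ->
  (forall A, measurable A -> nu A = variation_measure mu_sin A) ->
  (nu D < +oo)%E.
Proof.
move=> mD vsin var_fin muE ac [N [mN N0 sinN]] nuE.
apply: le_lt_trans var_fin; rewrite nuE//.
apply: ge_ereal_sup => _ [n [F [mF tF UF ->]]].
have FN i : mu_sin (F i) = mu (F i `&` N).
  have mFN : measurable (F i `&` N) by exact: measurableI.
  rewrite muE// ac//; last first.
    by apply: (subset_measure0 mFN mN) => //; exact: subIsetr.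
  rewrite add0r -{1}(setUIDK (F i) N) (vector_measureU vsin)//.
  - by rewrite sinN// addr0.
  - exact: measurableD.
  - by apply/seteqP; split => // t [[_ ?] []].
(* the pieces F i within N, completed to a partition of the whole line *)
pose G (i : 'I_n.+1) : set B :=
  if unlift ord0 i is Some j then F j `&` N else ~` (D `&` N).
apply: (@le_trans _ _ (\sum_(i < n.+1) `|mu (G i)|)%:E).
  rewrite lee_fin big_ord_recl ler_wpDl//; apply: ler_sum => i _.
  by rewrite /G liftK FN.
apply: ereal_sup_ubound; exists n.+1, G; split => //.
- move=> i; rewrite /G; case: unliftP => [j _|_]; first exact: measurableI.
  by apply: measurableC; exact: measurableI.
- move=> i j _ _; rewrite /G.
  case: unliftP => [i'|] ->; case: unliftP => [j'|] -> [t []].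
  + by move=> [Fi _] [Fj _]; congr lift; apply: (tF _ _ Logic.I Logic.I); exists t.
  + by move=> [Fi Nt] []; split => //; rewrite -UF; exists i'.
  + by move=> DN [Fj Nt]; exfalso; apply: DN; split => //; rewrite -UF; exists j'.
  + by [].
- apply/seteqP; split => // t _.
  have [[Dt Nt]|DNt] := pselect ((D `&` N) t).
    move: Dt; rewrite -UF => -[i _ Fit].
    by exists (lift ord0 i) => //; rewrite /G liftK.
  by exists ord0 => //; rewrite /G unlift_none.
Qed.

(** Uniform approximation reduces the integral to sums of c f(mu A_c) over level
    sets.  On a level set c lies within e of the values of phi, so that the
    nonnegative c contribute at most m I up to O(e), and the negative ones,
    which exceed - e, are absorbed by M. *)
Lemma vector_integral_le {V : normedModType R} D I (mu : set B -> V)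
    (f : dual V) (m M : {measure set B -> \bar R}) (phi : R -> R) (v : V) :
  measurable D -> measurable I -> (m setT < +oo)%E -> (M setT < +oo)%E ->
  (forall A, measurable A -> A `<=` D -> ((f (mu A))%:E <= m A)%E) ->
  (forall A, measurable A -> A `<=` D -> ((- f (mu A))%:E <= M A)%E) ->
  (forall t, D t -> 0 <= phi t <= 1) ->
  (forall t, D t -> ~ I t -> phi t = 0) ->
  is_vector_integral D mu phi v -> ((f v)%:E <= m I)%E.
Proof.
move=> mD mI moo Moo fm fM phi01 phiI [s_ [ss sphi sv]].
have mfin (F : set B) : measurable F -> m F \is a fin_num by exact: measure_fin.
have Mfin (F : set B) : measurable F -> M F \is a fin_num by exact: measure_fin.
(* the errors on the level sets add up to e (K - 1) *)
pose K := fine (m D) + fine (M D) + 1.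
have K0 : 0 < K by rewrite ltr_wpDl// addr_ge0// fine_ge0.
rewrite -(fineK (mfin I mI)) lee_fin; apply/ler_addgt0Pr => e' e'0.
pose e := e' / K.
have e0 : 0 < e by rewrite divr_gt0.
have fsv := cvg_comp _ _ sv ((dualP f).2 v).
apply: (cvgr_to_le fsv); apply: filterS (sphi e e0) => n hn /=.
have [fs ms] := ss n.
set s := s_ n in hn fs ms *.
rewrite fsbig_finite// dual_sum.
pose F c : set B := D `&` s @^-1` [set c].
have mF c : measurable (F c) by exact: measurableI.
apply: (@le_trans _ _ (\sum_(c <- finmap.enum_fset (fset_set (range s)))
   (fine (m ((D `&` I) `&` s @^-1` [set c])) + e * (fine (m (F c)) + fine (M (F c)))))).
  apply: ler_sum => c _; rewrite dualZ -/(F c).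
  have FD : F c `<=` D by exact: subIsetl.
  have fmc : f (mu (F c)) <= fine (m (F c)).
    by rewrite -lee_fin fineK ?mfin//; exact: fm.
  have fMc : - f (mu (F c)) <= fine (M (F c)).
    by rewrite -lee_fin fineK ?Mfin//; exact: fM.
  have m0 A : 0 <= fine (m A) by rewrite fine_ge0.
  have M0 A : 0 <= fine (M A) by rewrite fine_ge0.
  (* values c that s takes only outside D carry no information on phi *)
  have [[t [Dt /= stc]]|F0] := pselect (exists t, F c t); last first.
    have F0' : F c = set0 by apply/seteqP; split=> // t Ft; apply: F0; exists t.
    move: fmc fMc; rewrite F0' !measure0 /= => fmc fMc.
    have -> : f (mu set0) = 0 by lra.
    by rewrite mulr0 addr0 mulr0 addr0.
  have cphi t' : F c t' -> `|c - phi t'| <= e by move=> [Dt' /= <-]; exact: hn.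
  have /andP[ph0 ph1] := phi01 _ Dt.
  have := cphi t (conj Dt stc); rewrite ler_distl => /andP[ce1 ce2].
  have [c0|c0] := ltP c 0.
    have ce : - c <= e by lra.
    have h1 : c * f (mu (F c)) <= - c * fine (M (F c)).
      by rewrite -mulrNN ler_wpM2l// oppr_ge0 ltW.
    have h2 : - c * fine (M (F c)) <= e * fine (M (F c)) by rewrite ler_wpM2r.
    have h3 : 0 <= e * fine (m (F c)) by rewrite mulr_ge0// ltW.
    by have := m0 (D `&` I `&` s @^-1` [set c]); lra.
  have h1 : c * f (mu (F c)) <= c * fine (m (F c)) by rewrite ler_wpM2l.
  have h3 : 0 <= e * fine (M (F c)) by rewrite mulr_ge0// ltW.
  have mFI : measurable (F c `&` I) by exact: measurableI.
  have mFD : measurable (F c `\` I) by exact: measurableD.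
  have mE : fine (m (F c)) =
      fine (m (D `&` I `&` s @^-1` [set c])) + fine (m (F c `\` I)).
    rewrite -{1}(setUIDK (F c) I) measureU//; last first.
      by apply/seteqP; split => // t' [[_ ?] []].
    rewrite fineD ?mfin//; congr (fine (m _) + _).
    by rewrite /F setIAC.
  (* off I the test function vanishes, so that c <= e there *)
  have h4 : c * fine (m (F c `\` I)) <= e * fine (m (F c `\` I)).
    have [[t' [Ft' It']]|F0] := pselect (exists t', (F c `\` I) t').
      rewrite ler_wpM2r//; have := cphi t' Ft'.
      by rewrite phiI//; [rewrite subr0 ger0_norm|case: Ft'].
    have -> : F c `\` I = set0 by apply/seteqP; split=> // t' Ft; apply: F0; exists t'.
    by rewrite measure0 !mulr0.
  have h5 : c * fine (m (D `&` I `&` s @^-1` [set c])) <=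
      (1 + e) * fine (m (D `&` I `&` s @^-1` [set c])).
    by rewrite ler_wpM2r//; lra.
  by rewrite mE mulrDr in h1; rewrite mE; lra.
rewrite big_split/= -mulr_sumr big_split/= !simple_measure_sum//; last exact: measurableI.
apply: lerD.
  apply: fine_le; rewrite ?mfin//; first exact: measurableI.
  by apply: le_measure; rewrite ?inE//; exact: measurableI.
rewrite /e mulrAC ler_pdivrMr// ler_wpM2l ?ltW//.
by rewrite /K ltrDl.
Qed.

End VectorMeasures.

(** * Measures that dominate the derivative *)

Section DerivativeDensity.
Context {R : realType} {X : normedModType R}.
Local Notation B := (measurableTypeR R).
Local Notation L := (@lebesgue_measure R).

(** The constant is moved to the measurable function p, since the norm of g need
    not be measurable. *)
Lemma minorant_integral_fin (nu : {measure set B -> \bar R}) (D : set B)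
    (g : R -> X) (p : R -> R) (C : R) : measurable D -> 0 < C ->
  measurable_fun setT (p : B -> R) -> (forall t, 0 <= p t) ->
  (forall t, D t -> p t <= C * `|g t|) ->
  (\int[nu]_(t in D) `|g t|%:E < +oo)%E ->
  nu.-integrable D (EFin \o p).
Proof.
move=> mD C0 mp p0 pC gfin; apply/integrableP; split.
  by apply/measurable_EFinP; exact: measurable_funTS.
under eq_integral do rewrite /= ger0_norm//.
have mCp : measurable_fun D (fun t : B => (C^-1 * p t)%:E).
  by apply/measurable_EFinP/measurable_funM => //; exact: measurable_funTS.
have Cp0 t : D t -> (0 <= (C^-1 * p t)%:E)%E.
  by rewrite lee_fin mulr_ge0// invr_ge0 ltW.
have -> : (\int[nu]_(t in D) (p t)%:E =
    C%:E * \int[nu]_(t in D) (C^-1 * p t)%:E)%E.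
  rewrite -(ge0_integralZl_EFin nu mD Cp0 mCp (ltW C0)).
  by apply: eq_integral => t _; rewrite -EFinM mulVKf// gt_eqF.
apply: lte_mul_pinfty; [by rewrite lee_fin ltW|by []|].
apply: le_lt_trans gfin; apply: ge0_le_integral_lower => t Dt.
  exact: Cp0.
by rewrite lee_fin ler_pdivrMl// pC.
Qed.

Variables (T : R) (u : R -> X) (du du_ac du_sin : set B -> X)
  (nu : {measure set B -> \bar R}) (uac usin : R -> X).
Hypothesis dec : derivative_decomposition T u du du_ac du_sin nu uac usin.

(** The densities of m are Borel minorants of k (uac) and k (usin): they are
    almost everywhere equal to them, as Jensen's inequality requires, and lie
    below them everywhere, as the last claim requires. *)
Lemma derivative_density_measure (k : X -> R) (C : R) : 0 < C ->
  continuous k -> (forall x, 0 <= k x) -> (forall x, k x <= C * `|x|) ->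
  exists m : {measure set B -> \bar R},
  [/\ (m setT < +oo)%E,
   forall f : dual X, (forall x, f x <= k x) ->
     forall A : set B, measurable A -> A `<=` `]0, T[ -> ((f (du A))%:E <= m A)%E &
   forall t, t <= T -> (m [set` `]0%R, t]] <=
     \int[L]_(s in `]0%R, t[) (k (uac s))%:E
     + \int[nu]_(s in `]0%R, t]) (k (usin s))%:E)%E].
Proof.
move=> C0 ck k0 kC.
pose D : set B := [set` `]0, T[].
have mD : measurable D by exact: measurable_itv.
have LD : (L D < +oo)%E.
  by rewrite lebesgue_measure_itv/= lte_fin; case: ifP => _; rewrite ltry.
have nuD : (nu D < +oo)%E.
  apply: (singular_part_finite mD (du_sin_measure dec) (du_bounded dec)
    (du_decomposition dec) (du_ac_continuous dec) (du_sin_singular dec)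
    (nu_variation dec)).
have [[suac fuac] acE] := uac_density dec.
have [[susin fusin] sinE] := usin_density dec.
have [p1 [mp1 p10 p1le p1ae]] := strongly_measurable_minorant mD suac ck k0.
have [p2 [mp2 p20 p2le p2ae]] := strongly_measurable_minorant mD susin ck k0.
have Ip1 : L.-integrable D (EFin \o p1).
  apply: (minorant_integral_fin mD C0 mp1 p10 _ fuac) => t Dt.
  exact: le_trans (p1le t Dt) (kC _).
have Ip2 : nu.-integrable D (EFin \o p2).
  apply: (minorant_integral_fin mD C0 mp2 p20 _ fusin) => t Dt.
  exact: le_trans (p2le t Dt) (kC _).
have [m mE] := density_sum_measure_exists L nu mD mp1 p10 mp2 p20.
exists m; split.
- rewrite mE setTI lte_add_pinfty// -ge0_fin_numE ?integrable_fin_num//.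
  + by apply: integral_ge0 => t _; rewrite lee_fin.
  + by apply: integral_ge0 => t _; rewrite lee_fin.
- move=> f fk A mA AD; rewrite mE (setIidl AD) (du_decomposition dec)// dualD EFinD.
  apply: leeD.
  + apply: (bochner_integral_le mA _ (acE A mA AD)).
    * by apply: le_lt_trans LD; apply: le_measure; rewrite ?inE.
    * exact: integrableS Ip1.
    * by apply: filterS p1ae => t h At; rewrite h//; exact: AD.
  + apply: (bochner_integral_le mA _ (sinE A mA AD)).
    * by apply: le_lt_trans nuD; apply: le_measure; rewrite ?inE.
    * exact: integrableS Ip2.
    * by apply: filterS p2ae => t h At; rewrite h//; exact: AD.
move=> t tT; rewrite mE; apply: leeD.
- have -> : (\int[L]_(s in [set` `]0%R, t]] `&` D) (p1 s)%:E =
      \int[L]_(s in [set` `]0%R, t[]) (p1 s)%:E)%E.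
    move: tT; rewrite le_eqVlt => /predU1P[->|tT].
      rewrite setIidr//; exact: subset_itv_oo_oc.
    rewrite setIidl ?integral_itv_bndo_bndc//.
      by apply/measurable_EFinP; exact: measurable_funTS.
    by move=> s; rewrite /D/= !in_itv/= => /andP[-> /le_lt_trans ->].
  apply: ge0_le_integral_lower => s; first by rewrite lee_fin.
  rewrite /= in_itv/= lee_fin => /andP[s0 st]; apply: p1le.
  by rewrite /D/= in_itv/= s0 (lt_le_trans st tT).
- rewrite integral_mkcondr; apply: ge0_le_integral_lower => s _.
    by rewrite patchE; case: ifPn => //; rewrite lee_fin.
  rewrite patchE; case: ifPn => [/set_mem Ds|_]; rewrite lee_fin//.
  exact: p2le.
Qed.

End DerivativeDensity.

(** * Increments of a function and its distributional derivative *)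

Section StepTest.
Context {R : realType} {X : normedModType R}.
Local Notation B := (measurableTypeR R).
Variables (T : R) (u : R -> X) (du : set B -> X) (f : dual X)
  (m M : {measure set B -> \bar R}).
Hypotheses (T_gt0 : 0 < T) (du_derivative : distributional_derivative T u du)
  (m_fin : (m setT < +oo)%E) (M_fin : (M setT < +oo)%E)
  (fm : forall A : set B, measurable A -> A `<=` `]0, T[ ->
     ((f (du A))%:E <= m A)%E)
  (fM : forall A : set B, measurable A -> A `<=` `]0, T[ ->
     ((- f (du A))%:E <= M A)%E).

(** Tested against a difference phi of smooth steps, the distributional
    derivative yields a vector x with f x at most m of the support of phi, while
    - x, the integral of phi' u, averages f o u near p and near q. *)
Lemma smooth_step_test_le (p q e a b d : R) : 0 < e -> 0 < p -> p <= q ->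
  q + e < T -> (forall t, p <= t <= p + e -> f (u t) <= a + d) ->
  (forall t, q <= t <= q + e -> b - d <= f (u t)) ->
  ((b - a - 2 * d)%:E <= m [set` `[p, (q + e)%R]])%E.
Proof.
move=> e0 p0 pq qeT fa fb.
pose phi := step_combination p q e 1 (-1).
have phiE t : phi t = smooth_step p e t - smooth_step q e t.
  by rewrite /phi /step_combination mul1r mulN1r.
have phi01 t : 0 <= phi t <= 1.
  rewrite phiE subr_ge0 smooth_step_antitone//=.
  have := smooth_step_le1 p e t; have := smooth_step_ge0 q e t; lra.
have phi_supp t : ~ (p <= t <= q + e) -> phi t = 0.
  move=> /negP; rewrite negb_and -!ltNge phiE => /orP[tp|tq].
    by rewrite !smooth_step_eq0 ?subrr//; lra.
  by rewrite !smooth_step_eq1 ?subrr//; lra.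
have tphi : test_function T phi.
  split; first exact/flat_generated_smooth/step_combination_generated.
  exists p, (q + e); split => // t pt0; apply: contraTT pt0 => /negP.
  by move=> /phi_supp ->; rewrite eqxx.
have [x [vx bx]] := du_derivative tphi.
have mD : measurable ([set` `]0, T[] : set B) by exact: measurable_itv.
have mI : measurable ([set` `[p, (q + e)%R]] : set B) by exact: measurable_itv.
have fx : ((f x)%:E <= m [set` `[p, (q + e)%R]])%E.
  apply: (vector_integral_le mD mI m_fin M_fin fm fM _ _ vx) => t _ //.
  by move=> It; apply: phi_supp => h; apply: It; rewrite /= in_itv.
(* on the supports of the two derivatives f o u is replaced by the constants
   a + d and b - d, which makes the majorant of f (phi' u) the derivative of
   a smooth function *)
pose G := step_combination p q e (a + d) (- (b - d)).
have [IG iG] := flat_generated_FTC T_gt0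
  (step_combination_generated p q e (a + d) (- (b - d))).
have LD : (lebesgue_measure ([set` `]0%R, T[] : set B) < +oo)%E.
  by rewrite lebesgue_measure_itv/= lte_fin; case: ifP => _; rewrite ltry.
have := @bochner_integral_le _ _ _ _ _ _ f _ mD LD bx IG.
move=> /(_ _)/wrap[].
  apply: aeW => t _; rewrite dualZ !step_combination_derive1.
  set sp := derive1 (smooth_step p e) t; set sq := derive1 (smooth_step q e) t.
  have sp0 : 0 <= sp by exact: smooth_step_derive_ge0.
  have sq0 : 0 <= sq by exact: smooth_step_derive_ge0.
  have h1 : sp * f (u t) <= sp * (a + d).
    have [pt|pt] := boolP (p <= t <= p + e); first exact: ler_wpM2l sp0 _ _ (fa t pt).
    by rewrite /sp smooth_step_derive_eq0// !mul0r.
  have h2 : sq * (b - d) <= sq * f (u t).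
    have [qt|qt] := boolP (q <= t <= q + e); first exact: ler_wpM2l sq0 _ _ (fb t qt).
    by rewrite /sq smooth_step_derive_eq0// !mul0r.
  lra.
have sT (r : R) : r + e < T -> smooth_step r e T = 1.
  by move=> reT; rewrite smooth_step_eq1// ltW.
have s0 (r : R) : 0 < r -> smooth_step r e 0 = 0.
  by move=> r0; rewrite smooth_step_eq0// ltW.
rewrite iG /step_combination !sT ?s0//; [|lra..].
rewrite dualN lee_fin => h.
by apply: le_trans fx; rewrite lee_fin; lra.
Qed.

End StepTest.

Section OneSided.
Context {R : realType}.

Lemma near_at_right (P : R -> Prop) (a : R) : (\forall s \near a^'+, P s) ->
  exists2 e : R, 0 < e & forall s, a < s < a + e -> P s.
Proof.
move=> [e /= e0 he]; exists e => // s /andP[as_ se]; apply: he => //=.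
by rewrite ltr_distlC; lra.
Qed.

Lemma near_at_left (P : R -> Prop) (a : R) : (\forall s \near a^'-, P s) ->
  exists2 e : R, 0 < e & forall s, a - e < s < a -> P s.
Proof.
move=> [e /= e0 he]; exists e => // s /andP[as_ se]; apply: he => //=.
by rewrite ltr_distlC; lra.
Qed.

End OneSided.

Section Jumps.
Context {R : realType} {X : normedModType R}.
Local Notation B := (measurableTypeR R).
Variables (T : R) (u : R -> X) (du : set B -> X) (f : dual X)
  (m M : {measure set B -> \bar R}).
Hypotheses (T_gt0 : 0 < T) (du_derivative : distributional_derivative T u du)
  (m_fin : (m setT < +oo)%E) (M_fin : (M setT < +oo)%E)
  (fm : forall A : set B, measurable A -> A `<=` `]0, T[ ->
     ((f (du A))%:E <= m A)%E)
  (fM : forall A : set B, measurable A -> A `<=` `]0, T[ ->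
     ((- f (du A))%:E <= M A)%E).

Lemma dual_cvg_dist_le {F : set_system R} {FF : Filter F} (y : X) (d : R) :
  0 < d -> u s @[s --> F] --> y ->
  \forall s \near F, f y - d <= f (u s) <= f y + d.
Proof.
move=> d0 uy; have := cvg_comp _ _ uy ((dualP f).2 y).
move=> /cvgrPdistC_le /(_ d d0); apply: filterS => s /=.
by rewrite ler_distl.
Qed.

(** The steps are placed within the interval at distance e from its end points,
    so that the test function never leaves it while its derivative only sees
    values of u close to the one-sided limits. *)
Lemma interval_test_le (a b : R) (r l : X) : 0 <= a -> a < b -> b <= T ->
  u s @[s --> a^'+] --> r -> u s @[s --> b^'-] --> l ->
  ((f l - f r)%:E <= m [set` `]a, b[])%E.
Proof.
move=> a0 ab bT ur ul.
have mfin : m [set` `]a, b[] \is a fin_num by exact: measure_fin.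
rewrite -(fineK mfin) lee_fin; apply/ler_addgt0Pr => d' d'0.
pose d := d' / 2.
have d0 : 0 < d by rewrite divr_gt0.
have [e1 e10 h1] := near_at_right (dual_cvg_dist_le d0 ur).
have [e2 e20 h2] := near_at_left (dual_cvg_dist_le d0 ul).
pose e := Num.min (Num.min e1 e2) (b - a) / 3.
have m0 : 0 < Num.min (Num.min e1 e2) (b - a) by rewrite !lt_min e10 e20 subr_gt0.
have e0 : 0 < e by rewrite divr_gt0.
have [ee1 ee2 eba] : [/\ 3 * e <= e1, 3 * e <= e2 & 3 * e <= b - a].
  by split; rewrite /e mulrC divfK// ?ge_min ?lexx ?orbT.
have := @smooth_step_test_le _ _ T u du f m M T_gt0 du_derivative m_fin M_fin fm fM
  (a + e) (b - 2 * e) e (f r) (f l) d e0.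
move=> /(_ _)/wrap[]; first lra.
move=> /(_ _)/wrap[]; first lra.
move=> /(_ _)/wrap[]; first lra.
move=> /(_ _)/wrap[].
  move=> t /andP[t1 t2]; suff /h1/andP[] : a < t < a + e1 by [].
  by apply/andP; split; lra.
move=> /(_ _)/wrap[].
  move=> t /andP[t1 t2]; suff /h2/andP[] : b - e2 < t < b by [].
  by apply/andP; split; lra.
have mle : (m [set` `[(a + e)%R, (b - 2 * e + e)%R]] <= m [set` `]a, b[])%E.
  apply: le_measure; rewrite ?inE; [exact: measurable_itv|exact: measurable_itv|].
  by apply: subset_itv; rewrite bnd_simp; lra.
move=> /le_trans/(_ mle); rewrite -(fineK mfin) lee_fin /d; lra.
Qed.

(** The steps are placed on both sides of t.  The supports of the test functions
    shrink to t, and m is continuous from above. *)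
Lemma point_test_le (t : R) (l r : X) : 0 < t < T ->
  u s @[s --> t^'-] --> l -> u s @[s --> t^'+] --> r ->
  ((f r - f l)%:E <= m [set t])%E.
Proof.
move=> /andP[t0 tT] ul ur.
have mfin : m [set t] \is a fin_num by exact: measure_fin.
rewrite -(fineK mfin) lee_fin; apply/ler_addgt0Pr => d' d'0.
pose d := d' / 2.
have d0 : 0 < d by rewrite divr_gt0.
have [e1 e10 h1] := near_at_right (dual_cvg_dist_le d0 ur).
have [e2 e20 h2] := near_at_left (dual_cvg_dist_le d0 ul).
pose e0 := Num.min (Num.min e1 e2) (Num.min t (T - t)) / 3.
have m0 : 0 < Num.min (Num.min e1 e2) (Num.min t (T - t)).
  by rewrite !lt_min e10 e20 t0 subr_gt0.
have e00 : 0 < e0 by rewrite divr_gt0.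
have [ee1 ee2 et eTt] : [/\ 3 * e0 <= e1, 3 * e0 <= e2, 3 * e0 <= t & 3 * e0 <= T - t].
  by split; rewrite /e0 mulrC divfK// ?ge_min ?lexx ?orbT.
pose e (n : nat) := e0 / n.+1%:R.
have e_gt0 n : 0 < e n by rewrite divr_gt0.
have e_le n : e n <= e0.
  by rewrite ler_pdivrMr// ler_peMr ?ler1n// ltW.
pose F n : set B := [set` `[t - 2 * e n, t + e n + e n]].
have Fge n : ((f r - f l - 2 * d)%:E <= m (F n))%E.
  have en0 := e_gt0 n; have ene := e_le n.
  apply: (@smooth_step_test_le _ _ T u du f m M T_gt0 du_derivative m_fin M_fin fm fM
    (t - 2 * e n) (t + e n) (e n) (f l) (f r) d) => //; try lra.
    move=> s /andP[s1 s2]; suff /h2/andP[] : t - e2 < s < t by [].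
    by apply/andP; split; lra.
  move=> s /andP[s1 s2]; suff /h1/andP[] : t < s < t + e1 by [].
  by apply/andP; split; lra.
have mF n : measurable (F n) by exact: measurable_itv.
have capF : \bigcap_n F n = [set t].
  apply/seteqP; split=> [s Fs|_ -> n _]; last first.
    by rewrite /F/= in_itv/=; have := e_gt0 n; lra.
  apply/eqP; apply: contraT => st.
  have ts : 0 < `|s - t| by rewrite normr_gt0 subr_eq0.
  have [n hn] : exists n : nat, 2 * e n < `|s - t|.
    exists (Num.truncn (2 * e0 / `|s - t|)).
    rewrite /e mulrA ltr_pdivrMr// [ltRHS]mulrC -ltr_pdivrMr//.
    exact: truncnS_gt.
  have := Fs n Logic.I; rewrite /F/= in_itv/= => /andP[s1 s2].
  have : `|s - t| <= 2 * e n by rewrite ler_distl; lra.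
  by rewrite leNgt hn.
have niF : nonincreasing_seq F.
  move=> i j ij; rewrite subsetEset; apply: subset_itv; rewrite bnd_simp.
    have : e j <= e i by rewrite ler_pM2l// lef_pV2 ?posrE// ler_nat.
    lra.
  have : e j <= e i by rewrite ler_pM2l// lef_pV2 ?posrE// ler_nat.
  lra.
have F0 : (m (F 0%N) < +oo)%E.
  by rewrite -ge0_fin_numE//; exact: measure_fin.
have mcap : measurable (\bigcap_n F n) by rewrite capF.
have cvgF := nonincreasing_cvg_mu F0 mF mcap niF.
have : ((f r - f l - 2 * d)%:E <= m [set t])%E.
  rewrite -capF; apply: (cvge_to_ge cvgF).
  by apply: nearW => n /=; exact: Fge.
rewrite -(fineK mfin) lee_fin /d; lra.
Qed.

End Jumps.

(** * The pointwise variation *)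

Section PsiVariation.
Context {R : realType} {X : normedModType R}.
Local Notation B := (measurableTypeR R).
Variables (psi : X -> R) (C : R).
Hypotheses (psi_sub : sublinear psi) (psiC : forall x, psi x <= C * `|x|).
Variables (T : R) (u : R -> X) (du : set B -> X) (m M : {measure set B -> \bar R}).
Hypotheses (T_gt0 : 0 < T) (du_derivative : distributional_derivative T u du)
  (m_fin : (m setT < +oo)%E) (M_fin : (M setT < +oo)%E)
  (dum : forall f : dual X, (forall x, f x <= psi x) ->
     forall A : set B, measurable A -> A `<=` `]0, T[ -> ((f (du A))%:E <= m A)%E)
  (duM : forall f : dual X, (forall x, f x <= C * `|x|) ->
     forall A : set B, measurable A -> A `<=` `]0, T[ -> ((f (du A))%:E <= M A)%E).

(** The functional f controls du from above through m, and - f through M,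
    which absorbs the error terms of the approximation by simple functions. *)
Lemma supporting_functional_bounds x : exists f : dual X,
  [/\ f x = psi x,
   forall A : set B, measurable A -> A `<=` `]0, T[ -> ((f (du A))%:E <= m A)%E &
   forall A : set B, measurable A -> A `<=` `]0, T[ -> ((- f (du A))%:E <= M A)%E].
Proof.
have [f [fpsi fx]] := supporting_functional psi_sub psiC x.
exists f; split => //; first exact: dum.
apply: (duM (f := - f)) => y.
change (- f y <= C * `|y|); rewrite -dualN -normrN.
exact: le_trans (fpsi _) (psiC _).
Qed.

Lemma psi_interval_le (a b : R) (r l : X) : 0 <= a -> a < b -> b <= T ->
  u s @[s --> a^'+] --> r -> u s @[s --> b^'-] --> l ->
  ((psi (l - r))%:E <= m [set` `]a, b[])%E.
Proof.
move=> a0 ab bT ur ul.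
have [f [<- fm fM]] := supporting_functional_bounds (l - r).
by rewrite dualB; exact: (interval_test_le T_gt0 du_derivative m_fin M_fin fm fM).
Qed.

Lemma psi_point_le (t : R) (l r : X) : 0 < t < T ->
  u s @[s --> t^'-] --> l -> u s @[s --> t^'+] --> r ->
  ((psi (r - l))%:E <= m [set t])%E.
Proof.
move=> tT ul ur.
have [f [<- fm fM]] := supporting_functional_bounds (r - l).
by rewrite dualB; exact: (point_test_le T_gt0 du_derivative m_fin M_fin fm fM).
Qed.

Hypothesis u_good : good_representative T u.

(** At the end points, where a good representative does not jump, theta is set
    to 0: this keeps the increments of the potential correct on intervals that
    start at 0 or end at T. *)
Lemma good_representative_choice : exists (l r : R -> X) (theta : R -> R),
  (forall t, 0 < t <= T -> u s @[s --> t^'-] --> l t) /\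
  (forall t, 0 <= t < T -> u s @[s --> t^'+] --> r t) /\
  (forall t, 0 <= theta t <= 1) /\
  theta 0 = 0 /\ theta T = 0 /\ r 0 = u 0 /\ l T = u T /\
  (forall t, 0 < t < T -> u t = (1 - theta t) *: l t + theta t *: r t).
Proof.
have [u0 uT ut] := u_good.
have /choice[w hw] : forall t : R, exists w : X * X * R, 0 < t < T ->
    [/\ u s @[s --> t^'-] --> w.1.1, u s @[s --> t^'+] --> w.1.2,
        0 <= w.2 <= 1 & u t = (1 - w.2) *: w.1.1 + w.2 *: w.1.2].
  move=> t; have [tT|tT] := boolP (0 < t < T); last by exists (0, 0, 0).
  by have [l [r [th h]]] := ut t tT; exists (l, r, th).
exists (fun t => if 0 < t < T then (w t).1.1 else u t).
exists (fun t => if 0 < t < T then (w t).1.2 else u t).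
exists (fun t => if 0 < t < T then (w t).2 else 0).
split.
  move=> t /andP[t0]; rewrite le_eqVlt => /predU1P[->|tT].
    by rewrite ltxx andbF.
  by rewrite t0 tT/=; case: (hw t) => //; rewrite t0.
split.
  move=> t /andP[]; rewrite le_eqVlt => /predU1P[<-|t0] tT.
    by rewrite ltxx.
  by rewrite t0 tT/=; case: (hw t) => //; rewrite t0.
split; first by move=> t; case: ifPn => [/hw[]//|_]; rewrite lexx ler01.
rewrite !ltxx andbF; do 4 split => //.
by move=> t tT; rewrite tT; case: (hw t tT).
Qed.

(** The potential is the mass of the open interval from 0 to t together with
    the share of the mass of the jump at t that the value u t has already
    covered on the segment between the one-sided limits. *)
Lemma psi_variation_potential : exists N : R -> R, [/\ N 0 = 0,
  forall t, 0 < t <= T -> ((N t)%:E <= m [set` `]0%R, t]])%E &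
  forall a b, 0 <= a -> a < b -> b <= T -> psi (u b - u a) <= N b - N a].
Proof.
have [l [r [th [ul [ur [th01 [th0 [thT [r0 [lT uE]]]]]]]]]] :=
  good_representative_choice.
have mfin A : measurable A -> m A \is a fin_num by exact: measure_fin.
pose N t := fine (m [set` `]0%R, t[]) + th t * fine (m [set t]).
have mpt t : 0 <= fine (m [set t]) by rewrite fine_ge0.
exists N; split.
- by rewrite /N th0 mul0r addr0 set_itvoo0 measure0.
- move=> t /andP[t0 tT]; rewrite -(@setUitv1 _ _ _ t true) ?bnd_simp//.
    rewrite measureU//; last first.
      by apply/seteqP; split => // s [/= si se]; move: si; rewrite se in_itv/= ltxx andbF.
  rewrite /N EFinD fineK; last by apply: mfin; exact: measurable_itv.
  apply: leeD2l; rewrite -[leRHS]fineK ?mfin// lee_fin.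
  by have /andP[_ h1] := th01 t; rewrite ler_piMl.
move=> a b a0 ab bT.
have bb : 0 < b <= T by rewrite (le_lt_trans a0 ab).
have aa : 0 <= a < T by rewrite a0 (lt_le_trans ab bT).
(* the increment of u from a to b crosses the rest of the jump at a, the open
   interval, and the first part of the jump at b *)
have left_le : psi (u b - l b) <= th b * fine (m [set b]).
  have [bT'|bT'] := ltP b T; last first.
    have -> : b = T by apply/eqP; rewrite eq_le bT bT'.
    by rewrite lT subrr sublinear0// thT mul0r.
  have b0T : 0 < b < T by rewrite bT' (le_lt_trans a0 ab).
  have := psi_point_le b0T (ul _ bb) (ur b _).
  move=> /(_ _)/wrap[]; first by case/andP: b0T => /ltW ->.
  rewrite -[X in (_ <= X)%E]fineK ?mfin// lee_fin => h.
  have -> : u b - l b = th b *: (r b - l b).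
    by rewrite uE// scalerBl scale1r scalerBr -addrA addrC addrA subrK.
  have /andP[thb0 _] := th01 b.
  by rewrite sublinearZ_ge0// ler_wpM2l.
have right_le : 0 < a -> psi (r a - u a) <= (1 - th a) * fine (m [set a]).
  move=> a0'; have a0T : 0 < a < T by rewrite a0'; case/andP: aa.
  have := psi_point_le a0T (ul a _) (ur _ aa).
  move=> /(_ _)/wrap[]; first by case/andP: a0T => -> /ltW ->.
  rewrite -[X in (_ <= X)%E]fineK ?mfin// lee_fin => h.
  have -> : r a - u a = (1 - th a) *: (r a - l a).
    rewrite uE// opprD addrCA -[X in _ + (X - _)]scale1r -scalerBl scalerBr.
    by rewrite addrC.
  have /andP[_ tha1] := th01 a.
  by rewrite sublinearZ_ge0 ?subr_ge0// ler_wpM2l// subr_ge0.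
have mid_le : psi (l b - r a) <= fine (m [set` `]a, b[]).
  rewrite -lee_fin fineK; last by apply: mfin; exact: measurable_itv.
  by apply: psi_interval_le => //; [exact: ur|exact: ul].
have split_le : psi (u b - u a) <= psi (u b - l b) + psi (l b - r a) + psi (r a - u a).
  have -> : u b - u a = (u b - l b) + (l b - r a) + (r a - u a).
    by rewrite [_ + (l b - r a)]addrA subrK addrA subrK.
  by rewrite (le_trans (psi_sub.1 _ _))// lerD2r psi_sub.1.
have [a0'|a0'] := ltP 0 a; last first.
  have aE : a = 0 by apply/eqP; rewrite eq_le a0 a0'.
  move: mid_le split_le; rewrite aE r0 subrr (sublinear0 psi_sub) addr0.
  by rewrite /N th0 set_itvoo0 measure0 mul0r/=; lra.
have mE : fine (m [set` `]0%R, b[]) =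
    fine (m [set` `]0%R, a[]) + fine (m [set a]) + fine (m [set` `]a, b[]).
  have mo c d : measurable ([set` `]c, d[] : set B) by exact: measurable_itv.
  have -> : [set` `]0%R, b[] = ([set` `]0%R, a[] `|` [set a]) `|` [set` `]a, b[] :> set B.
    apply/seteqP; split=> s /=; rewrite !in_itv/=.
      move=> /andP[s0 sb]; have [sa|sa|->] := ltgtP s a; [left; left|right|left; right] => //.
      - by rewrite s0.
    by move=> [[/andP[s0 sa]|->]|/andP[sa sb]]; lra.
  rewrite !measureU//.
  - by rewrite !fineD ?mfin// fin_numD !mfin.
  - by apply/seteqP; split => // s [/= si se]; move: si; rewrite se in_itv/= ltxx andbF.
  - exact: measurableU.
  - apply/seteqP; split => // s [/= [|->]]; rewrite !in_itv/= ?ltxx//.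
    by move=> /andP[_ sa] /andP[as_ _]; move: (lt_trans sa as_); rewrite ltxx.
by have := right_le a0'; rewrite /N mE; lra.
Qed.

Lemma psi_variation_le t : 0 <= t <= T ->
  (psi_variation psi u t <= m [set` `]0%R, t]])%E.
Proof.
have [N [N0 Nm Nle]] := psi_variation_potential.
have le_last (s : seq R) x : path <%R x s -> x <= last x s.
  elim: s x => //= y s IHs x /andP[xy /IHs]; apply: le_trans; exact: ltW.
have sum_le (s : seq R) : forall a, 0 <= a -> path <%R a s -> last a s <= T ->
    \sum_(i < size s) psi (u (nth 0 (a :: s) i.+1) - u (nth 0 (a :: s) i))
      <= N (last a s) - N a.
  elim: s => [|x s IHs] a a0 /=; first by rewrite big_ord0 subrr.
  move=> /andP[ax xs] sT; rewrite big_ord_recl/=.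
  have xT : x <= T by exact: le_trans (le_last _ _ xs) sT.
  have x0 : 0 <= x by exact: le_trans a0 (ltW ax).
  have := IHs x x0 xs sT; have := Nle a x a0 ax xT; lra.
move=> /andP[t0 tT]; apply: ge_ereal_sup => _ [s [ps /eqP st] <-].
have := sum_le s 0 (lexx 0) ps; rewrite st N0 subr0 => /(_ tT) h.
have /predU1P[t00|t00] : (0 == t) || (0 < t) by rewrite -le_eqVlt.
  apply: (@le_trans _ _ 0%E) => //.
  by rewrite lee_fin (le_trans h)// -t00 N0.
by apply: le_trans (Nm t _); rewrite ?lee_fin// t00.
Qed.

End PsiVariation.

(** * Functions with values in the polar set *)

Section Excess.
Context {R : realType} {X : normedModType R}.
Variable (psi : X -> R).
Hypotheses (psi_sub : sublinear psi) (psi_ge0 : forall x, 0 <= psi x).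
Local Notation B := (measurableTypeR R).

(** A 1-Lipschitz function of f that is positive exactly when f exceeds psi
    somewhere; it serves as a distance to the polar set. *)
Definition excess (f : dual X) : R :=
  sup [set f x - psi x | x in [set x : X | `|x| <= 1]].

Lemma excess_ub (f : dual X) x : `|x| <= 1 -> f x - psi x <= excess f.
Proof.
move=> x1; apply: ub_le_sup; last by exists x.
exists `|f| => _ [y /= y1 <-].
have : f y <= `|f|.
  rewrite (le_trans (ler_norm _))// (le_trans (dual_le f y))//.
  by rewrite ler_piMr.
by have := psi_ge0 y; lra.
Qed.

Lemma excess_le (f : dual X) (c : R) :
  (forall x, `|x| <= 1 -> f x - psi x <= c) -> excess f <= c.
Proof.
move=> h; apply: ge_sup; first by exists (f 0 - psi 0), 0 => //=; rewrite normr0.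
by move=> _ [x /= x1 <-]; exact: h.
Qed.

Lemma excess_ge0 (f : dual X) : 0 <= excess f.
Proof.
have := @excess_ub f 0; rewrite normr0 dual0 sublinear0// subrr; exact.
Qed.

Lemma excess_dist (f g : dual X) : excess f <= excess g + `|f - g|.
Proof.
apply: excess_le => x x1.
have h : f x - g x <= `|f - g|.
  change ((f - g) x <= `|f - g|).
  rewrite (le_trans (ler_norm _))// (le_trans (dual_le (f - g) x))//.
  by rewrite ler_piMr.
by have := excess_ub g x1; lra.
Qed.

Lemma excess_continuous : continuous (fun f : dual X => excess (- f)).
Proof.
apply: (lipschitz_continuous ltr01) => f g; rewrite mul1r.
by have := excess_dist (- f) (- g); rewrite -opprD normrN.
Qed.

Lemma excess_le0 (f : dual X) : excess f <= 0 -> forall y, f y <= psi y.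
Proof.
move=> f0 y; have [->|y0] := eqVneq y 0; first by rewrite dual0.
have n0 : 0 < `|y| by rewrite normr_gt0.
have := @excess_ub f (`|y|^-1 *: y).
rewrite normrZ normfV normr_id mulVf ?gt_eqF// => /(_ (lexx _)).
rewrite dualZ psi_sub.2 ?invr_gt0// -mulrBr => h.
have := le_trans h f0; rewrite pmulr_rle0 ?invr_gt0//; lra.
Qed.

(** The set where - xi leaves the polar set is, up to a null set, the Borel set
    where a version of the excess is positive; an infinite integrand forces it
    to be null. *)
Lemma ae_le_of_integral_fin (nu : {measure set B -> \bar R}) (D : set B)
    (xi : R -> dual X) (F : B -> \bar R) : measurable D ->
  strongly_measurable nu D xi -> (forall t, (0 <= F t)%E) ->
  (forall t, ~ (forall y, (- xi t) y <= psi y) -> F t = +oo%E) ->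
  (\int[nu]_(t in D) F t < +oo)%E ->
  {ae nu, forall t, D t -> forall y, (- xi t) y <= psi y}.
Proof.
move=> mD sxi F0 Foo intF.
have [p [mp p0 ple pae]] :=
  strongly_measurable_minorant mD sxi excess_continuous (fun f => excess_ge0 (- f)).
pose S : set B := D `&` p @^-1` `]0, +oo[.
have mS : measurable S.
  by apply: measurableI => //; rewrite -[X in measurable X]setTI; exact: mp.
have S0 : nu S = 0%E.
  apply/eqP; apply: contraT => nS0; exfalso.
  have : (\int[nu]_(t in D) (cst +oo%E \_ S) t <= \int[nu]_(t in D) F t)%E.
    apply: ge0_le_integral_lower => t Dt; rewrite patchE; case: ifPn => //.
      by rewrite leey.
    move=> /set_mem[_ /=]; rewrite in_itv/= andbT => pt.
    rewrite Foo// => h.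
    suff : excess (- xi t) <= 0 by have := ple t Dt; lra.
    by apply: excess_le => x _; have := h x; lra.
  rewrite -integral_mkcondr (setIidr (@subIsetl _ _ _)) integral_cst//.
  rewrite gt0_mulye; last by rewrite lt0e nS0 measure_ge0.
  by rewrite leye_eq => /eqP Foo'; rewrite Foo' in intF.
have Sae : {ae nu, forall t, ~ S t}.
  by exists S; split => // t /= /contrapT.
apply: filterS2 pae Sae => t pt nS Dt; apply: excess_le0.
rewrite -pt// leNgt; apply/negP => p_gt0; apply: nS; split => //=.
by rewrite in_itv/= p_gt0.
Qed.

End Excess.

(** * The energy inequality *)

Theorem proposition4p9 (R : realType) (X : completeNormedModType R)
    (X_reflexive : reflexive_space X)
    (T : R) (T_gt0 : 0 < T)
    (psi : X -> R)
    (psi_ge0 : forall x, 0 <= psi x)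
    (psi_convex : convex_function setT psi)
    (psi_lsc : lower_semicontinuous (EFin \o psi))
    (psi_homogeneous : forall (l : R) (x : X), 0 < l ->
      psi (l *: x) = l * psi x)
    (D : set X) (E : R -> X -> \bar R) (dtE : R -> X -> R)
    (E_energy : energy_assumptions T D E dtE)
    (u : R -> X) (u_BV : BV T u)
    (u_good : good_representative T u)
    (du du_ac du_sin : set (measurableTypeR R) -> X)
    (nu : {measure set (measurableTypeR R) -> \bar R})
    (uac usin : R -> X)
    (u_derivative :
      derivative_decomposition T u du du_ac du_sin nu uac usin)
    (xi : R -> dual X)
    (xi_L1 : bochner_integrable lebesgue_measure `]0, T[ xi)
    (E_initial : (E 0%R (u 0%R) < +oo)%E)
    (dtE_integrable : lebesgue_measure.-integrable `]0, T[
      (fun s => (dtE s (u s))%:E))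
    (energy_inequality : forall t, t \in `[0, T] ->
      (E t (u t)
       + \int[lebesgue_measure]_(s in `]0%R, t[)
           fitzpatrick (subdifferential psi) (uac s) (- xi s)%R
       + \int[nu]_(s in `]0%R, t])
           recession (fitzpatrick (subdifferential psi)) (usin s) 0%R
       <= E 0%R (u 0%R)
          + \int[lebesgue_measure]_(s in `]0%R, t[) (dtE s (u s))%:E)%E) :
  {ae lebesgue_measure, forall t, t \in `]0, T[ ->
     polar [set x | psi x <= 1] (- xi t)} /\
  (forall t, t \in `[0, T] ->
     (E t (u t) + psi_variation psi u t
      <= E 0%R (u 0%R)
         + \int[lebesgue_measure]_(s in `]0%R, t[) (dtE s (u s))%:E)%E).

Proof.
have psi_sub := convex_homogeneous_sublinear psi_convex psi_homogeneous.
have [C C0 psiC] := lsc_sublinear_bounded psi_sub psi_lsc.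
have psi_cont := sublinear_continuous C0 psi_sub psiC.
have Cnorm_cont : continuous (fun x : X => C * `|x|).
  by move=> x; apply: cvgMr; apply: cvg_norm.
have Cnorm_ge0 (x : X) : 0 <= C * `|x| by rewrite mulr_ge0// ltW.
have [m [m_fin dum m_le]] :=
  derivative_density_measure u_derivative C0 psi_cont psi_ge0 psiC.
have [M [M_fin duM _]] := derivative_density_measure u_derivative C0 Cnorm_cont
  Cnorm_ge0 (fun x => lexx _).
have fitz_ge0 (x : X) f : (0 <= fitzpatrick (subdifferential psi) x f)%E.
  by apply: le_trans (fitzpatrick_ge psi_sub psiC x f); rewrite lee_fin.
have rec_ge0 (x : X) : (0 <= recession (fitzpatrick (subdifferential psi)) x 0%R)%E.
  by apply: le_trans (recession_fitzpatrick_ge psi_sub psi_ge0 psiC x); rewrite lee_fin.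
split; last first.
  move=> t t0T; move: (t0T); rewrite in_itv/= => /andP[t0 tT].
  apply: le_trans (energy_inequality t t0T); rewrite -addeA leeD2l//.
  have t0T' : 0 <= t <= T by rewrite t0.
  apply: le_trans (psi_variation_le psi_sub psiC T_gt0 (du_derivative u_derivative)
    m_fin M_fin dum duM u_good t0T') _.
  apply: le_trans (m_le t tT) _; apply: leeD; apply: ge0_le_integral_lower => s _.
  - by rewrite lee_fin.
  - exact: fitzpatrick_ge.
  - by rewrite lee_fin.
  - exact: recession_fitzpatrick_ge.
have TT : T \in `[0, T] by rewrite in_itv/= lexx ltW.
have ET : (-oo < E T (u T))%E by exact: energy_gtNy E_energy _ _ TT.
have F_fin : (\int[lebesgue_measure]_(s in `]0%R, T[)
    fitzpatrick (subdifferential psi) (uac s) (- xi s)%R < +oo)%E.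
  rewrite ltey; apply/eqP => Foo.
  have := energy_inequality T TT; rewrite Foo addey ?gt_eqF//.
  rewrite addye; last by rewrite gt_eqF// (lt_le_trans (ltNyr 0))// integral_ge0.
  rewrite leye_eq => /eqP RHS.
  have : (E 0%R (u 0%R) +
      \int[lebesgue_measure]_(s in `]0%R, T[) (dtE s (u s))%:E < +oo)%E.
    apply: lte_add_pinfty => //.
    have := integrable_fin_num _ dtE_integrable.
    by rewrite fin_numElt => /(_ _)/wrap[|/andP[]].
  by rewrite RHS.
have [sxi _] := xi_L1.
have mD : measurable ([set` `]0, T[] : set (measurableTypeR R)) by exact: measurable_itv.
have := ae_le_of_integral_fin psi_sub psi_ge0 mD sxi
  (fun t => fitz_ge0 (uac t) (- xi t)) _ F_fin.
move=> /(_ _)/wrap[]; first by move=> t; exact: fitzpatrick_pinfty.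
apply: filterS => t h tT x /= px1.
exact: le_trans (h tT x) px1.
Qed.
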